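(* Assume $ef>1$ and $q>3$. Then $\mathrm{End}_G(\pi_0)=\overline{\mathbb F}_p$, i.e. every $G$-equivariant $\overline{\mathbb F}_p$-linear endomorphism of $\pi_0$ is multiplication by a scalar in $\overline{\mathbb F}_p$.
   Context: Let $p$ be a prime and $F$ a finite extension of $\mathbb Q_p$ with ramification index $e$, residue degree $f$, ring of integers $\mathcal O$, uniformizer $\varpi$ and residue field $\mathbb F_q$, $q=p^f$. Let $G=\mathrm{GL}_2(F)$, $Z$ its center, $K=\mathrm{GL}_2(\mathcal O)$. For $x\in\mathbb F_q$, $[x]\in\mathcal O$ is its multiplicative (Teichmüller) representative, and $I_1=\{[x]:x\in\mathbb F_q\}$. Let $\sigma_0$ be the trivial representation of $KZ$ over $\overline{\mathbb F}_p$ and $\mathrm{ind}_{KZ}^G\sigma_0$ its compact induction, spanned by the elements $[g,1]$ ($g\in G$), the characteristic functions of the cosets $gKZ$, with $h\cdot[g,1]=[hg,1]$. The standard spherical Hecke operator $T$ on $\mathrm{ind}_{KZ}^G\sigma_0$ is the $G$-equivariant operator $$T[g,1]=\sum_{\lambda\in I_1}\left[g\begin{pmatrix}\varpi&\lambda\\0&1\end{pmatrix},1\right]+\left[g\begin{pmatrix}1&0\\0&\varpi\end{pmatrix},1\right]$$ (i.e. it sends a vertex of the Bruhat–Tits tree to the sum of its $q+1$ neighbours). The universal supersingular representation is $\pi_0=\mathrm{ind}_{KZ}^G\sigma_0/\mathrm{Im}\,T$. *)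

(* Defs.v *)
From HB Require Import structures.
From mathcomp Require Import all_boot all_order all_algebra all_field.
From mathcomp Require Import boolp functions.

Set Implicit Arguments.
Unset Strict Implicit.
Unset Printing Implicit Defensive.

Import GRing.Theory.
Local Open Scope ring_scope.
Local Open Scope quotient_scope.

Section ClassicalUnits.
Variable A : comNzRingType.

(** Every commutative ring becomes a unit ring by excluded middle and choice. *)
Definition cunit : {pred A} := fun x => `[< exists y, y * x = 1 >].

Definition cinv (x : A) : A :=
  if pselect (exists y, y * x = 1) is left ex then sval (cid ex) else x.

Lemma cmulVx : {in cunit, left_inverse 1 cinv *%R}.
Proof.
move=> x /asboolP xU; rewrite /cinv; case: pselect => // ex.
by case: (cid ex).
Qed.

Lemma cunitPl (x y : A) : y * x = 1 -> cunit x.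
Proof. by move=> yx; apply/asboolP; exists y. Qed.

Lemma cinv_out : {in [predC cunit], cinv =1 id}.
Proof.
move=> x /negP xU; rewrite /cinv; case: pselect => // ex.
by case: xU; apply/asboolP.
Qed.

End ClassicalUnits.

Definition Zp_coherent (p : nat) : {pred forall n, 'Z_(p ^ n.+1)} :=
  fun x => `[< forall n, (x n.+1 : nat)%:R = x n :> 'Z_(p ^ n.+1) >].
Arguments Zp_coherent : clear implicits.

(** Z_p is the inverse limit of the rings Z/p^(n+1); the primality proof is a
    parameter so that the integral domain structure can be inferred. *)
Record padic_int (p : nat) (p_pr : prime p) : Type := PadicInt {
  Zp_seq :> forall n, 'Z_(p ^ n.+1);
  Zp_seqP : Zp_seq \in Zp_coherent p }.

Section Padic.
Variables (p : nat) (p_pr : prime p).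
Local Notation Zp_int := (padic_int p_pr).
Local Notation Zp_coherent := (Zp_coherent p).

HB.instance Definition _ := [isSub for @Zp_seq p p_pr].
HB.instance Definition _ := [Choice of Zp_int by <:].

Lemma Zp_exp_gt1 n : (1 < p ^ n.+1)%N.
Proof. by rewrite -{1}(expn0 p) ltn_exp2l // prime_gt1. Qed.

Lemma Zp_natr_mod n m : ((m %% p ^ n.+1)%N)%:R = m%:R :> 'Z_(p ^ n.+1).
Proof. by rewrite Zp_nat_mod // Zp_exp_gt1. Qed.

Lemma Zp_red_mod n m : ((m %% p ^ n.+2)%N)%:R = m%:R :> 'Z_(p ^ n.+1).
Proof.
rewrite -[LHS]Zp_natr_mod modn_dvdm ?Zp_natr_mod //.
by rewrite dvdn_exp2l.
Qed.

Lemma Zp_coherentP (x : Zp_int) n : (x n.+1 : nat)%:R = x n :> 'Z_(p ^ n.+1).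
Proof. by have /asboolP := Zp_seqP x. Qed.

Lemma Zp_trunc_exp n : (Zp_trunc (p ^ n.+1)).+2 = (p ^ n.+1)%N.
Proof. exact: Zp_cast (Zp_exp_gt1 n). Qed.

Lemma Zp_ltn n (a : 'Z_(p ^ n.+1)) : (a < p ^ n.+1)%N.
Proof. by apply: leq_trans (ltn_ord a) _; rewrite Zp_trunc_exp. Qed.

Fact zero_coherent : (fun n => 0 : 'Z_(p ^ n.+1)) \in Zp_coherent.
Proof. by apply/asboolP => n. Qed.

Fact one_coherent : (fun n => 1 : 'Z_(p ^ n.+1)) \in Zp_coherent.
Proof. by apply/asboolP => n. Qed.

Lemma Zp_redD n (a b : 'Z_(p ^ n.+2)) :
  ((a + b)%R : nat)%:R = (a : nat)%:R + (b : nat)%:R :> 'Z_(p ^ n.+1).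
Proof.
rewrite -natrD -[RHS]Zp_red_mod; congr (_%:R).
by rewrite /=; congr (_ %% _)%N; apply: Zp_trunc_exp.
Qed.

Lemma Zp_redM n (a b : 'Z_(p ^ n.+2)) :
  ((a * b)%R : nat)%:R = (a : nat)%:R * (b : nat)%:R :> 'Z_(p ^ n.+1).
Proof.
rewrite -natrM -[RHS]Zp_red_mod; congr (_%:R).
by rewrite /=; congr (_ %% _)%N; apply: Zp_trunc_exp.
Qed.

Fact opp_coherent (x : Zp_int) : (fun n => - x n) \in Zp_coherent.
Proof.
apply/asboolP => n; apply/eqP; rewrite -subr_eq0 opprK -(Zp_coherentP x n).
by rewrite -Zp_redD addNr.
Qed.

Fact add_coherent (x y : Zp_int) : (fun n => x n + y n) \in Zp_coherent.
Proof. by apply/asboolP => n; rewrite Zp_redD !Zp_coherentP. Qed.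

Fact mul_coherent (x y : Zp_int) : (fun n => x n * y n) \in Zp_coherent.
Proof. by apply/asboolP => n; rewrite Zp_redM !Zp_coherentP. Qed.

Definition Zp_zero := PadicInt p_pr zero_coherent.
Definition Zp_one := PadicInt p_pr one_coherent.
Definition Zp_opp x := PadicInt p_pr (opp_coherent x).
Definition Zp_add x y := PadicInt p_pr (add_coherent x y).
Definition Zp_mul x y := PadicInt p_pr (mul_coherent x y).

Lemma Zp_intP (x y : Zp_int) : (forall n, x n = y n) -> x = y.
Proof. by move=> xy; apply/val_inj/functional_extensionality_dep. Qed.

Fact Zp_addA : associative Zp_add.
Proof. by move=> x y z; apply: Zp_intP => n; apply: addrA. Qed.
Fact Zp_addC : commutative Zp_add.
Proof. by move=> x y; apply: Zp_intP => n; apply: addrC. Qed.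
Fact Zp_add0 : left_id Zp_zero Zp_add.
Proof. by move=> x; apply: Zp_intP => n; apply: add0r. Qed.
Fact Zp_addN : left_inverse Zp_zero Zp_opp Zp_add.
Proof. by move=> x; apply: Zp_intP => n; apply: addNr. Qed.
HB.instance Definition _ :=
  GRing.isZmodule.Build Zp_int Zp_addA Zp_addC Zp_add0 Zp_addN.

Fact Zp_mulA : associative Zp_mul.
Proof. by move=> x y z; apply: Zp_intP => n; apply: mulrA. Qed.
Fact Zp_mulC : commutative Zp_mul.
Proof. by move=> x y; apply: Zp_intP => n; apply: mulrC. Qed.
Fact Zp_mul1 : left_id Zp_one Zp_mul.
Proof. by move=> x; apply: Zp_intP => n; apply: mul1r. Qed.
Fact Zp_mulDl : left_distributive Zp_mul +%R.
Proof. by move=> x y z; apply: Zp_intP => n; apply: mulrDl. Qed.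
Fact Zp_one_neq0 : Zp_one != 0.
Proof. by apply/eqP => /(congr1 (fun x : Zp_int => val (x 0%N))). Qed.
HB.instance Definition _ := GRing.Zmodule_isComNzRing.Build Zp_int
  Zp_mulA Zp_mulC Zp_mul1 Zp_mulDl Zp_one_neq0.

HB.instance Definition _ := GRing.ComNzRing_hasMulInverse.Build Zp_int
  (@cmulVx Zp_int) (@cunitPl Zp_int) (@cinv_out Zp_int).

Lemma Zp_red (x : Zp_int) n m : (n <= m)%N ->
  (x n : nat) = ((x m : nat) %% p ^ n.+1)%N.
Proof.
move=> /subnK <-; elim: (m - n)%N => [|d IH].
  by rewrite add0n modn_small // Zp_ltn.
rewrite IH addSn -(Zp_coherentP x (d + n)) val_Zp_nat ?Zp_exp_gt1 //.
by rewrite modn_dvdm // dvdn_exp2l // ltnS leq_addl.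
Qed.

Lemma Zp_neq0P (x : Zp_int) :
  x != 0 -> exists n, forall m, (n <= m)%N -> ~~ (p ^ n.+1 %| x m)%N.
Proof.
move=> x0; have [n xn0] : exists n, x n != 0.
  apply/not_existsP => all0; case/eqP: x0; apply: Zp_intP => n.
  by have /negP := all0 n; rewrite negbK => /eqP.
exists n => m nm; by rewrite /dvdn -Zp_red.
Qed.

Fact Zp_mulf_eq0 : GRing.integral_domain_axiom Zp_int.
Proof.
move=> x y xy0; apply/norP => -[/Zp_neq0P[n xn] /Zp_neq0P[m ym]].
pose N := (n + m).+1.
have nN : (n <= N)%N by rewrite leqW // leq_addr.
have mN : (m <= N)%N by rewrite leqW // leq_addl.
have : (p ^ N.+1 %| x N * y N)%N.
  have /(congr1 (fun z : Zp_int => val (z N))) /= := xy0.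
  by rewrite /dvdn => <-; apply/eqP; congr (_ %% _)%N; rewrite Zp_trunc_exp.
have xN0 : (0 < x N)%N.
  by rewrite lt0n; apply: contra (xn N nN) => /eqP->; rewrite dvdn0.
have yN0 : (0 < y N)%N.
  by rewrite lt0n; apply: contra (ym N mN) => /eqP->; rewrite dvdn0.
move: (xn N nN) (ym N mN); rewrite !pfactor_dvdn ?muln_gt0 ?xN0 //.
rewrite -!leqNgt lognM // => xl yl xyl.
by have := leq_trans xyl (leq_add xl yl); rewrite ltnNge leqnSn.
Qed.

HB.instance Definition _ := GRing.ComUnitRing_isIntegral.Build Zp_int Zp_mulf_eq0.

End Padic.

Notation Qp p_pr := {fraction (padic_int p_pr)}.

Section RingOfIntegers.
Variables (p : nat) (p_pr : prime p) (F : fieldExtType (Qp p_pr)).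

(** The ring of integers is the integral closure of Z_p in F. *)
Definition integer_pred : {pred F} :=
  fun x => `[< integralOver (in_alg F \o @tofrac (padic_int p_pr)) x >].

Fact integer_subring : subring_closed integer_pred.
Proof.
split.
- by apply/asboolP/integral1.
- by move=> x y /asboolP ? /asboolP ?; apply/asboolP/integral_sub.
- by move=> x y /asboolP ? /asboolP ?; apply/asboolP/integral_mul.
Qed.
HB.instance Definition _ :=
  GRing.isSubringClosed.Build F integer_pred integer_subring.

Record integers : Type := Integer {
  integer_val :> F;
  integer_valP : integer_val \in integer_pred }.

HB.instance Definition _ := [isSub for integer_val].
HB.instance Definition _ := [Choice of integers by <:].
HB.instance Definition _ := [SubChoice_isSubComNzRing of integers by <:].
HB.instance Definition _ := GRing.ComNzRing_hasMulInverse.Build integers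
  (@cmulVx integers) (@cunitPl integers) (@cinv_out integers).

Definition divides (x y : integers) : Prop := exists z, y = x * z.

(** [varpi] generates the ideal of non-units, the maximal ideal of the ring of
    integers. *)
Definition is_uniformizer (varpi : integers) : Prop :=
  forall x : integers, x \isn't a GRing.unit <-> divides varpi x.

Definition is_ramification_index (varpi : integers) (e : nat) : Prop :=
  exists2 u : integers, u \is a GRing.unit & p%:R = u * varpi ^+ e.

Definition is_residue_map (varpi : integers) (k : finFieldType)
    (red : {rmorphism integers -> k}) : Prop :=
  (forall y : k, exists x, red x = y) /\
  (forall x : integers, red x = 0 <-> divides varpi x).

(** A multiplicative section of the reduction map is unique: its nonzero values
    are (q-1)-st roots of unity, which are distinct in the residue field. *)
Definition is_teichmuller (k : finFieldType) (red : {rmorphism integers -> k})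
    (teich : k -> integers) : Prop :=
  cancel teich red /\ {morph teich : x y / x * y}.

End RingOfIntegers.

Section CompactInduction.
Variables (C : fieldType) (G : groupType) (H : groupClosed G).

(** Functions on G that are constant on the cosets gH and supported on finitely
    many of them. *)
Definition cind_pred : {pred G -> C^o} := fun f =>
  `[< (forall g h, h \in H -> f (g * h)%g = f g) /\
      (exists s : seq G, forall g, f g != 0 ->
         has (fun x => (x^-1 * g)%g \in H) s) >].

Fact cind_submod : submod_closed cind_pred.
Proof.
split; first by apply/asboolP; split=> //; exists [::] => g; rewrite eqxx.
move=> a u v /asboolP[uH [su uS]] /asboolP[vH [sv vS]].
apply/asboolP; split=> [g h hH|].
  by rewrite !fctE uH // vH.
exists (su ++ sv) => g; rewrite has_cat => uv0.
have [ug0|/uS -> //] := eqVneq (u g) 0.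
rewrite vS ?orbT //; apply: contra uv0 => /eqP vg0.
by rewrite !fctE ug0 vg0 scaler0 addr0.
Qed.
HB.instance Definition _ :=
  GRing.isSubmodClosed.Build C (G -> C^o) cind_pred cind_submod.

Record cind : Type := CInd {
  cind_fun :> G -> C^o;
  cind_funP : cind_fun \in cind_pred }.

HB.instance Definition _ := [isSub for cind_fun].
HB.instance Definition _ := [Choice of cind by <:].
HB.instance Definition _ := [SubChoice_isSubLmodule of cind by <:].

Fact cind_basis_proof (g : G) :
  (fun x : G => ((g^-1 * x)%g \in H)%:R : C) \in cind_pred.
Proof.
apply/asboolP; split=> [x h hH|]; first by rewrite mulgA gpredMr.
by exists [:: g] => x /=; case: (_ \in H); rewrite ?eqxx.
Qed.

Definition cind_basis (g : G) : cind := CInd (cind_basis_proof g).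

Fact cind_act_proof (g : G) (f : cind) :
  (fun x => f (g^-1 * x)%g) \in cind_pred.
Proof.
have /asboolP[fH [s fS]] := cind_funP f.
apply/asboolP; split=> [x h hH|]; first by rewrite mulgA fH.
exists [seq (g * y)%g | y <- s] => x /fS; rewrite has_map.
by congr is_true; apply: eq_has => y /=; rewrite invgM mulgA.
Qed.

(** Left translation. *)
Definition cind_act (g : G) (f : cind) : cind := CInd (cind_act_proof g f).

Lemma cind_act_basis g h : cind_act h (cind_basis g) = cind_basis (h * g)%g.
Proof.
by apply/val_inj/funext => x /=; rewrite invgM !mulgA.
Qed.

End CompactInduction.

Section Cokernel.
Variables (C : fieldType) (V : lmodType C) (T : {linear V -> V}).

Definition im_pred : {pred V} := fun v => `[< exists w, T w = v >].

Fact im_submod : submod_closed im_pred.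
Proof.
split; first by apply/asboolP; exists 0; rewrite linear0.
move=> a u v /asboolP[u' <-] /asboolP[v' <-].
by apply/asboolP; exists (a *: u' + v'); rewrite linearP.
Qed.
HB.instance Definition _ := GRing.isSubmodClosed.Build C V im_pred im_submod.

Definition coker : Type := Quotient.quot (im_pred : zmodClosed V).
HB.instance Definition _ := GRing.Zmodule.on coker.
HB.instance Definition _ :=
  EqQuotient.copy coker (Quotient.quot (im_pred : zmodClosed V)).
HB.instance Definition _ :=
  ZmodQuotient.copy coker (Quotient.quot (im_pred : zmodClosed V)).

Definition coker_scale (a : C) (x : coker) : coker := \pi_coker (a *: repr x).

Lemma coker_eqP (u v : V) :
  reflect (exists w, T w = u - v) (\pi_coker u == \pi_coker v).
Proof.
rewrite -[_ == _](Quotient.idealrBE im_pred u v).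
by apply: (iffP idP) => [/asboolP|?]; last apply/asboolP.
Qed.

Lemma coker_scale_pi a (v : V) : coker_scale a (\pi_coker v) = \pi_coker (a *: v).
Proof.
apply/eqP/coker_eqP.
have /eqP/coker_eqP[w Tw] : \pi_coker (repr (\pi_coker v)) = \pi_coker v.
  by rewrite reprK.
by exists (a *: w); rewrite linearZ /= Tw scalerBr.
Qed.

Fact coker_scaleA a b x :
  coker_scale a (coker_scale b x) = coker_scale (a * b) x.
Proof.
by rewrite -[x]reprK [coker_scale b _]coker_scale_pi !coker_scale_pi scalerA.
Qed.
Fact coker_scale1 : left_id 1 coker_scale.
Proof. by move=> x; rewrite -[x]reprK coker_scale_pi scale1r. Qed.
Fact coker_scaleDr : right_distributive coker_scale +%R.
Proof.
move=> a x y; rewrite -[x]reprK -[y]reprK -raddfD !coker_scale_pi.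
by rewrite scalerDr raddfD.
Qed.
Fact coker_scaleDl x : {morph coker_scale^~ x : a b / a + b}.
Proof. by move=> a b; rewrite -[x]reprK !coker_scale_pi scalerDl raddfD. Qed.
HB.instance Definition _ := GRing.Zmodule_isLmodule.Build C coker
  coker_scaleA coker_scale1 coker_scaleDr coker_scaleDl.

End Cokernel.

Section UnitGroup.
Variable R : unitRingType.

Record units : Type := Units { unit_val :> R; unit_valP : unit_val \is a GRing.unit }.

HB.instance Definition _ := [isSub for unit_val].
HB.instance Definition _ := [Choice of units by <:].

Definition unit_one := Units (unitr1 R).
Fact unit_mul_proof (x y : units) : unit_val x * unit_val y \is a GRing.unit.
Proof. by rewrite unitrMl unit_valP. Qed.
Definition unit_mul x y := Units (unit_mul_proof x y).
Fact unit_inv_proof (x : units) : (unit_val x)^-1 \is a GRing.unit.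
Proof. by rewrite unitrV unit_valP. Qed.
Definition unit_inv x := Units (unit_inv_proof x).

Fact unit_mulA : associative unit_mul.
Proof. by move=> x y z; apply/val_inj/mulrA. Qed.
Fact unit_mul1 : left_id unit_one unit_mul.
Proof. by move=> x; apply/val_inj/mul1r. Qed.
Fact unit_mulr1 : right_id unit_one unit_mul.
Proof. by move=> x; apply/val_inj/mulr1. Qed.
Fact unit_mulV : left_inverse unit_one unit_inv unit_mul.
Proof. by move=> x; apply/val_inj/mulVr/unit_valP. Qed.
Fact unit_mulrV : right_inverse unit_one unit_inv unit_mul.
Proof. by move=> x; apply/val_inj/mulrV/unit_valP. Qed.
HB.instance Definition _ := isGroup.Build units
  unit_mulA unit_mul1 unit_mulr1 unit_mulV unit_mulrV.

End UnitGroup.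

Definition GL2 (F : fieldType) := units 'M[F]_2.
HB.instance Definition _ (F : fieldType) := Group.on (GL2 F).

Definition mx22 (R : Type) (a b c d : R) : 'M[R]_2 :=
  \matrix_(i, j) if i == 0 then (if j == 0 then a else b)
                 else (if j == 0 then c else d).

(** [A] as an element of GL_2(F); defaults to 1 when [A] is singular. *)
Definition toGL2 (F : fieldType) (A : 'M[F]_2) : GL2 F := insubd (1%g : GL2 F) A.

Section KZ.
Variables (p : nat) (p_pr : prime p) (F : fieldExtType (Qp p_pr)).

Definition in_center (z : GL2 F) : Prop := forall g : GL2 F, commute z g.

Definition in_K (g : GL2 F) : Prop :=
  exists2 A : 'M[integers F]_2,
    A \in unitmx & unit_val g = map_mx (val : integers F -> F) A.

Definition KZ : {pred GL2 F} := fun g =>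
  `[< exists kappa z, [/\ in_K kappa, in_center z & g = (kappa * z)%g] >].

Fact in_K1 : in_K 1%g.
Proof. by exists 1%:M; rewrite ?unitmx1 // map_scalar_mx. Qed.

Fact in_KM g h : in_K g -> in_K h -> in_K (g * h)%g.
Proof.
move=> [A Au gA] [B Bu hB]; exists (A *m B); first by rewrite unitmx_mul Au.
by rewrite map_mxM /= -gA -hB.
Qed.

Fact in_KV g : in_K g -> in_K g^-1%g.
Proof.
move=> [A Au gA]; exists (invmx A); first by rewrite unitmx_inv.
have : unit_val g * map_mx (val : integers F -> F) (invmx A) = 1.
  by rewrite gA -[_ * _]map_mxM mulmxV // map_scalar_mx.
by move/(canRL (mulKr (unit_valP g))) => ->; rewrite mulr1.
Qed.

Fact KZ1 : 1%g \in KZ.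
Proof.
apply/asboolP; exists 1%g, 1%g; split; [exact: in_K1 | | by rewrite mulg1].
by move=> g; apply/commute_sym/commute1.
Qed.

Fact KZM : mulg_closed KZ.
Proof.
move=> _ _ /asboolP[a [z [aK zZ ->]]] /asboolP[b [y [bK yZ ->]]].
apply/asboolP; exists (a * b)%g, (z * y)%g; split; first exact: in_KM.
  by move=> g; apply/commute_sym/commuteM; apply/commute_sym.
by rewrite -!mulgA; congr (_ * _)%g; rewrite !mulgA zZ.
Qed.

Fact KZV : invg_closed KZ.
Proof.
move=> _ /asboolP[a [z [aK zZ ->]]].
have zVZ : in_center z^-1%g by move=> g; apply/commute_sym/commuteV/commute_sym.
apply/asboolP; exists a^-1%g, z^-1%g; split=> //; first exact: in_KV.
by rewrite invgM zVZ.
Qed.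

HB.instance Definition _ := isMulClosed.Build (GL2 F) KZ KZM.
HB.instance Definition _ := isMul1Closed.Build (GL2 F) KZ KZ1.
HB.instance Definition _ := isInvClosed.Build (GL2 F) KZ KZV.

End KZ.
Arguments KZ {p p_pr} F _.

Section Supersingular.
Variables (p : nat) (p_pr : prime p) (F : fieldExtType (Qp p_pr)).
Variable C : fieldType.

Definition ind0 := @cind C (GL2 F) (KZ F).
HB.instance Definition _ := GRing.Lmodule.on ind0.

(** The element [g,1] of the compact induction. *)
Definition bracket (g : GL2 F) : ind0 := @cind_basis C (GL2 F) (KZ F) g.

(** The formula determines [T], the elements [g,1] being a spanning family. The
    two matrices are invertible, so [toGL2] does not default. *)
Definition is_hecke (varpi : integers F) (k : finFieldType)
    (teich : k -> integers F) (T : {linear ind0 -> ind0}) : Prop :=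
  forall g : GL2 F,
    T (bracket g) =
      \sum_(x : k) bracket
         (g * toGL2 (mx22 (val varpi) (val (teich x)) 0 1)%R)%g
      + bracket (g * toGL2 (mx22 1 0 0 (val varpi))%R)%g.

Variable T : {linear ind0 -> ind0}.

Definition pi0 := coker T.
HB.instance Definition _ := GRing.Lmodule.on pi0.

Definition pi0_proj (v : ind0) : pi0 := \pi_(coker T) v.

Fact pi0_proj_linear : linear pi0_proj.
Proof.
move=> a u v; rewrite /pi0_proj raddfD; congr (_ + _).
exact/esym/coker_scale_pi.
Qed.

Definition pi0_act (g : GL2 F) (v : pi0) : pi0 :=
  pi0_proj (cind_act g (repr (v : coker T))).

Lemma cind_act_linear (g : GL2 F) :
  linear (cind_act g : ind0 -> ind0).
Proof. by move=> a u v; apply/val_inj. Qed.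

(** The action does not depend on the chosen representatives as soon as [T]
    commutes with the action of G. *)
Lemma pi0_act_proj :
  (forall (g : GL2 F) (v : ind0), T (cind_act g v) = cind_act g (T v)) ->
  forall (g : GL2 F) (v : ind0),
    pi0_act g (pi0_proj v) = pi0_proj (cind_act g v).
Proof.
move=> TG g v; apply/eqP/coker_eqP.
have /eqP/coker_eqP[w Tw] : \pi_(coker T) (repr (\pi_(coker T) v)) = \pi_(coker T) v.
  by rewrite reprK.
by exists (cind_act g w); rewrite TG Tw; apply/val_inj.
Qed.

End Supersingular.

(* Main.v *)
Require Import Defs.
From mathcomp Require Import all_boot all_order all_algebra all_field.
From mathcomp Require Import boolp functions ring.
Set Implicit Arguments.
Unset Strict Implicit.
Unset Printing Implicit Defensive.
Import GRing.Theory.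
Local Open Scope ring_scope.

(** Let [v0] be the class of [[1,1]] in [pi0 = V / T V], where [V] is the space
    of finitely supported functions on the vertices [gKZ] of the tree. It is
    fixed by [KZ] and generates [pi0], so an endomorphism [phi] is determined by
    [phi v0], which is fixed by [KZ] as well. The theorem therefore follows once
    the [KZ]-invariants of [pi0] are known to be the line spanned by [v0]
    ([fixed_mod_hecke]) and [v0] is known to be nonzero ([basis1_notin_hecke]).

    The level of [g] is the [n] such that [g] lies in the double coset
    [KZ diag(varpi^n, 1) KZ], the distance from [gKZ] to the base vertex. The
    value of [T f] at a vertex is the sum of [f] over its neighbours
    ([hecke_eval]). A vertex of level [n+1] has exactly one neighbour of level
    [n], its parent; the others have level [n+2]. If [f] lives in levels at most
    [n], the values of [T f] in level [n+1] are thus the values of [f] at the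
    parents ([hecke_top]). In particular [f] lives in levels at most [n] as soon
    as [T f] lives in levels at most [n+1] ([vanish_of_hecke]).

    Let now [f] represent a [KZ]-invariant class and live in levels at most
    [n+1]. For [y] in [KZ] the difference [y f - f] is [T w] with [w] in levels
    at most [n], so in level [n+1] it is constant on the children of each vertex
    [P] of level [n]. Label the children of [P] by residue classes [b]. If [y]
    fixes [P] and acts on its children by [b -> a b + c] with [a] and [a - 1]
    units, which is possible because [q > 2], then [y] fixes a child; the
    constant is then 0, so [f] takes the same value at the children [0] and [c].
    Varying [c], [f] is constant on the children of [P] ([fixed_children]). One
    neighbour of the base vertex escapes this labelling; the Weyl element brings
    it in ([fixed_top_well_defined]). Hence [f] agrees in level [n+1] with some
    [T w], and [f - T w] lives in levels at most [n] ([subtract_top]). Iterating,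
    [f] is modulo [T V] supported at the base vertex, that is, a multiple of
    [[1,1]].

    The arithmetic input is that the ring of integers of [F] is a discrete
    valuation ring with fraction field [F]. It yields the Cartan decomposition
    ([at_level_ex], [at_level_inj]) and the description of the neighbours of a
    vertex ([nbr_cover], [nbr_inj]). *)

(** * The ring of integers is a discrete valuation ring *)

Section PadicIntegers.
Variables (p : nat) (p_pr : prime p).

Lemma Zp_natrE (m n : nat) : (m%:R : padic_int p_pr) n = m%:R.
Proof. by elim: m => // m IH; rewrite !mulrS -IH. Qed.

(** If [v] is the valuation of [a] then [a = p^v u], where [u] is prime to [p]
    modulo each power of [p]; the inverses of the reductions of [u] are coherent
    and define [c]. *)
Lemma Zp_dvd_expn (a : padic_int p_pr) :
  a != 0 -> exists m c, a * c = p%:R ^+ m.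
Proof.
move=> a0; have ex : exists n, a n != 0.
  apply/not_existsP => all0; case/eqP: a0; apply: Zp_intP => n.
  by have /negP := all0 n; rewrite negbK => /eqP.
case: (ex_minnP ex) => v av0 vmin; exists v.
have p_gt0 := prime_gt0 p_pr; have pX_gt0 n : (0 < p ^ n)%N by rewrite expn_gt0 p_gt0.
(* Dividing by [p^v] costs [v] digits, hence the shift of the index. *)
pose u n := (a (n + v)%N %/ p ^ v)%N.
have aE n : (a (n + v) = u n * p ^ v :> nat)%N.
  rewrite divnK //; case: v av0 vmin @u => [|v] av0 vmin _; first by rewrite dvd1n.
  rewrite /dvdn -Zp_red; last by rewrite addnS ltnW // ltnS leq_addl.
  have [->//|] := eqVneq (a v) 0.
  by move=> /vmin; rewrite ltnn.
have uE n : u n = (u n.+1 %% p ^ n.+1)%N.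
  rewrite /u (@Zp_red _ _ a _ (n.+1 + v)) ?leq_add2r //.
  by rewrite modn_divl -expnD addSn.
have cop n : coprime p (u n).
  rewrite prime_coprime //; apply: contra av0 => pu.
  apply/eqP/val_inj; rewrite /= (@Zp_red _ _ a _ (n + v)) ?leq_addl // aE.
  by apply/eqP; rewrite -/(dvdn _ _) expnS dvdn_pmul2r.
have uU n : (u n)%:R \is a @GRing.unit 'Z_(p ^ n.+1).
  by rewrite unitZpE ?Zp_exp_gt1 // coprimeXl.
pose c n : 'Z_(p ^ n.+1) := (u n)%:R^-1.
have cP : c \in Zp_coherent p.
  apply/asboolP => n; apply: (mulIr (uU n)); rewrite (mulVr (uU n)).
  have := Zp_redM p_pr (c n.+1) (u n.+1)%:R; rewrite (mulVr (uU n.+1)) => /esym.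
  rewrite val_Zp_nat ?Zp_exp_gt1 // Zp_red_mod // -(Zp_natr_mod p_pr n (u n.+1)) -uE.
  by move->.
exists (PadicInt p_pr cP); apply: Zp_intP => n.
rewrite -natrX Zp_natrE /= /c; apply: (mulIr (uU n)).
rewrite -mulrA (mulVr (uU n)) mulr1 -natrM mulnC -aE.
rewrite -[RHS](Zp_natr_mod p_pr) -Zp_red ?leq_addr //.
by rewrite natr_Zp.
Qed.

End PadicIntegers.

Lemma fraction_numden (R : idomainType) (c : {fraction R}) :
  exists n d : R, d != 0 /\ c * tofrac d = tofrac n.
Proof.
exists (\n_(repr c)), (\d_(repr c)); split; first exact: denom_ratioP.
rewrite -{1}[c]reprK /FracField.tofrac; unlock.
rewrite -[LHS]FracField.pi_mul; apply/eqmodP.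
rewrite /= FracField.equivfE /FracField.mulf !numden_Ratio ?oner_neq0 ?mulf_neq0 ?denom_ratioP //.
by rewrite !mulr1 mulrC.
all: exact: oner_neq0.
Qed.

Lemma cancel_frac (K : fieldType) (s u a b : K) :
  s != 0 -> b != 0 -> u * (a * b) / (s * b) = u * s^-1 * a.
Proof. by move=> s0 b0; field; rewrite s0 b0. Qed.

Section DVR.
Variables (p : nat) (p_pr : prime p) (F : fieldExtType (Qp p_pr)).
Variables (varpi : integers F) (e : nat).
Hypothesis varpiP : is_uniformizer varpi.
Hypothesis e_gt0 : (0 < e)%N.
Hypothesis eP : is_ramification_index varpi e.
Local Notation O := (integers F).
Local Notation v := (val : O -> F).
Local Notation Zemb := (in_alg F \o @tofrac (padic_int p_pr)).

Lemma Zemb_integer a : Zemb a \in @integer_pred p p_pr F.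
Proof. by apply/asboolP; apply: integral_id. Qed.

Lemma val_unit_neq0 (u : O) : u \is a GRing.unit -> v u != 0.
Proof.
apply: contraTneq => u0; have -> : u = 0 by apply: val_inj; rewrite u0 rmorph0.
by rewrite unitr0.
Qed.

Lemma val_unitV (u : O) : u \is a GRing.unit -> v u^-1 = (v u)^-1.
Proof.
move=> uU; have u0 := val_unit_neq0 uU.
by apply: (mulfI u0); rewrite divff // -rmorphM divrr // rmorph1.
Qed.

(** An equation of [x] over Z_p, divided by a power of ['X], has a nonzero
    constant term [a]. It shows that [x] divides [a], and [a] divides a power of
    [p], hence of [varpi]. *)
Lemma varpi_exp_multiple (x : O) :
  x != 0 -> exists y N, x * y = varpi ^+ N.
Proof.
move=> x0; have v0 : v x != 0 by apply: contra_neq x0 => v0; apply: val_inj; rewrite v0 rmorph0.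
have /asboolP[P Pmon Px] := integer_valP x.
have [m [Q]] := multiplicity_XsubC P 0.
rewrite monic_neq0 //= => Q0 PE.
have Qx : root (map_poly Zemb Q) (v x).
  move: Px; rewrite PE rmorphM rmorphXn /= map_polyXsubC raddf0 subr0.
  by rewrite rootM => /orP[//|]; rewrite /root hornerXn expf_eq0 (negPf v0) andbF.
move: Qx Q0 {PE}; elim/poly_ind: Q => [|R a _]; first by rewrite root0.
rewrite /root hornerMXaddC mulr0 add0r rmorphD rmorphM /= map_polyX map_polyC /=.
rewrite hornerMXaddC => /eqP Rx a0.
have Ry : (map_poly Zemb R).[v x] \in @integer_pred p p_pr F.
  apply: rpred_horner; last exact: integer_valP.
  by apply/polyOverP => i; rewrite coef_map Zemb_integer.
have [n [c ac]] := Zp_dvd_expn a0.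
have [u uU pE] := eP.
exists (- Integer Ry * Integer (Zemb_integer c) * u ^- n), (e * n)%N.
have -> : varpi ^+ (e * n) = p%:R ^+ n * u ^- n.
  by rewrite pE exprMn exprM mulrAC mulrV ?unitrX // mul1r.
rewrite mulrA; congr (_ * _); apply: val_inj.
rewrite mulrA mulrN !rmorphM rmorphN rmorphM rmorphXn rmorph_nat /=.
move/eqP: Rx; rewrite addrC addr_eq0 mulrC => /eqP Rx.
rewrite -Rx -[LHS](rmorphM Zemb) ac.
by rewrite rmorphXn rmorph_nat.
Qed.

Lemma p_neq0 : p%:R != 0 :> F.
Proof.
rewrite -[_%:R](rmorph_nat Zemb) fmorph_eq0 tofrac_eq0.
apply: contraTneq isT => /(congr1 (fun a : padic_int p_pr => val (a 1%N))) /=.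
rewrite Zp_natrE val_Zp_nat ?Zp_exp_gt1 // modn_small => [p0|].
  by have := prime_gt0 p_pr; rewrite p0.
by rewrite -{1}(expn1 p) ltn_exp2l // prime_gt1.
Qed.

Lemma varpi_neq0 : v varpi != 0.
Proof.
apply: contra_neq p_neq0 => w0; have [u uU pE] := eP.
rewrite -(rmorph_nat v) pE rmorphM rmorphXn /= w0 expr0n.
by case: e e_gt0 => // n _; rewrite mulr0.
Qed.

(** Dividing a nonunit by [varpi] lowers the power of [varpi] that it divides,
    so the divisions stop at a unit. *)
Lemma unit_varpi_factor (x : O) :
  x != 0 -> exists2 u, u \is a GRing.unit & exists n, x = u * varpi ^+ n.
Proof.
move/varpi_exp_multiple => [y [N]].
elim: N x => [|N IH] x xy.
  exists x; last by exists 0%N; rewrite mulr1.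
  by apply/asboolP; exists y; rewrite mulrC xy.
have [xU|xU] := boolP (x \is a GRing.unit).
  by exists x => //; exists 0%N; rewrite mulr1.
have [x' xE] := (varpiP x).1 xU; rewrite xE in xy *.
have [] := IH x'.
  by apply/val_inj/(mulfI varpi_neq0); rewrite -!rmorphM mulrA xy exprS.
by move=> u uU [n ->]; exists u => //; exists n.+1; rewrite exprS mulrCA.
Qed.

Lemma p_power_integer m n (x : F) : (m <= n)%N ->
  (p%:R ^+ m * x) \in @integer_pred p p_pr F ->
  (p%:R ^+ n * x) \in @integer_pred p p_pr F.
Proof.
move=> /subnK <- mx; rewrite exprD -mulrA; apply: rpredM => //.
by apply/rpredX/rpred_nat.
Qed.

(** If [p^M] clears the denominators of the minimal polynomial [P] of [x], of
    degree [d], then [p^M x] is a root of the monic polynomial with coefficients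
    [P_i p^(M (d - i))]. *)
Lemma p_power_multiple (x : F) :
  exists m, (p%:R ^+ m * x) \in @integer_pred p p_pr F.
Proof.
pose P := minPoly 1%VS x; pose d := (size P).-1.
have Pmon : P \is monic := monic_minPoly _ _.
have sP : size P = d.+1 by rewrite prednK // size_poly_gt0 monic_neq0.
have cP i : exists m, (p%:R ^+ m * P`_i) \in @integer_pred p p_pr F.
  have /vlineP[c ->] := polyOverP (minPolyOver 1%VS x) i.
  have [n [b [b0 cb]]] := fraction_numden c; have [m [b' bb']] := Zp_dvd_expn b0.
  exists m.
  suff -> : p%:R ^+ m * c%:A = Zemb (n * b') by apply: Zemb_integer.
  have -> : p%:R ^+ m = in_alg F (tofrac (b * b')).
    by rewrite bb' -[RHS]/(Zemb (p%:R ^+ m)) rmorphXn rmorph_nat.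
  rewrite -[c%:A]/(in_alg F c) -rmorphM; congr (in_alg F _).
  by rewrite [in LHS]rmorphM [RHS]rmorphM /= -cb mulrC mulrA.
have [M MP] : exists M, forall i, (i < size P)%N ->
    (p%:R ^+ M * P`_i) \in @integer_pred p p_pr F.
  elim: (size P) => [|n [M MP]]; first by exists 0%N.
  have [m mP] := cP n; exists (maxn M m) => i.
  rewrite ltnS leq_eqVlt => /orP[/eqP->|/MP].
    by apply: p_power_integer mP; apply: leq_maxr.
  by apply: p_power_integer; apply: leq_maxl.
exists M; apply/asboolP.
pose Q := \poly_(i < d.+1) (P`_i * (p%:R ^+ M) ^+ (d - i)).
have Qd : Q`_d = 1.
  by rewrite coef_poly leqnn subnn mulr1; have /monicP := Pmon; rewrite lead_coefE.
have sQ : size Q = d.+1.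
  apply/eqP; rewrite eqn_leq size_poly /= ltnNge.
  by apply: contra_eqN Qd => /(nth_default 0)->; rewrite eq_sym oner_neq0.
have Qmon : Q \is monic by rewrite monicE lead_coefE sQ Qd.
apply: (integral_root_monic Qmon).
  rewrite /root horner_poly.
  have -> : \sum_(i < d.+1) P`_i * (p%:R ^+ M) ^+ (d - i) * (p%:R ^+ M * x) ^+ i
      = (p%:R ^+ M) ^+ d * P.[x].
    rewrite horner_coef sP mulr_sumr; apply: eq_bigr => i _.
    have -> : (p%:R ^+ M) ^+ d = (p%:R ^+ M) ^+ (d - i) * (p%:R ^+ M) ^+ i :> F.
      by rewrite -exprD subnK // -ltnS.
    by rewrite exprMn [P`_i * _]mulrC mulrACA.
  by have /rootP-> := root_minPoly 1%VS x; rewrite mulr0.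
apply/integral_poly => i; apply/asboolP.
change (Q`_i \in @integer_pred p p_pr F).
rewrite coef_poly; case: ltnP => [|_]; last exact: rpred0.
rewrite ltnS leq_eqVlt => /orP[/eqP->|id].
  by have := Qd; rewrite coef_poly leqnn => ->; apply: rpred1.
rewrite -[(d - i)%N]prednK ?subn_gt0 // exprS mulrA [_ * _ ^+ M]mulrC.
apply: rpredM; last by do 2!apply: rpredX; apply: rpred_nat.
by apply: MP; rewrite sP ltnW.
Qed.

(** Both [p^M] and the integer [p^M x] are units times powers of [varpi]; the
    sign of the difference of the two exponents decides which case holds. *)
Lemma integer_or_inv (x : F) :
  x != 0 -> x \in @integer_pred p p_pr F \/ x^-1 \in @integer_pred p p_pr F.
Proof.
move=> x0; have [M xM] := p_power_multiple x.
have [|s sU [n yE]] := @unit_varpi_factor (Integer xM).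
  apply/eqP => /(congr1 v)/eqP; rewrite rmorph0 /= mulf_eq0 (negPf x0) orbF.
  by rewrite expf_eq0 (negPf p_neq0) andbF.
have [u uU pE] := eP.
have {}yE : v u ^+ M * v varpi ^+ (e * M) * x = v s * v varpi ^+ n.
  move/(congr1 v): yE; rewrite [RHS]rmorphM rmorphXn /= => <-.
  by rewrite -(rmorph_nat v) pE rmorphM rmorphXn /= exprMn exprM.
have w0 := varpi_neq0.
have [u0 s0] := (val_unit_neq0 uU, val_unit_neq0 sU).
have xE : x = v s * v varpi ^+ n / (v u ^+ M * v varpi ^+ (e * M)).
  by rewrite -yE mulrC mulKf // mulf_neq0 ?expf_neq0.
case: (leqP (e * M) n) => [le|/ltnW le]; [left|right].
  rewrite xE -(subnK le) exprD cancel_frac ?expf_neq0 // -exprVn -val_unitV //.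
  by rewrite -!rmorphXn -!rmorphM; apply: integer_valP.
rewrite xE -(subnK le) exprD invf_div cancel_frac ?expf_neq0 // -val_unitV //.
by rewrite -!rmorphXn -!rmorphM; apply: integer_valP.
Qed.

End DVR.

(** * Computations in GL_2 of a field *)

#[local] Hint Extern 0 (is_true (1 != 0)) => exact: oner_neq0 : core.

Section Matrices.
Variable K : fieldType.
Implicit Types a b c d : K.

Lemma mx22E (R : Type) (A : 'M[R]_2) : A = mx22 (A 0 0) (A 0 1) (A 1 0) (A 1 1).
Proof.
apply/matrixP => i j; rewrite mxE.
by case: i j => [[|[|//]] i] [[|[|//]] j] /=; congr (A _ _); apply: val_inj.
Qed.

Lemma mx22_inj (R : Type) (a b c d a' b' c' d' : R) :
  mx22 a b c d = mx22 a' b' c' d' -> [/\ a = a', b = b', c = c' & d = d'].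
Proof.
move=> /matrixP E; split; [move: (E 0 0)|move: (E 0 1)|move: (E 1 0)|move: (E 1 1)];
  by rewrite !mxE.
Qed.

Lemma mulmx22 (R : pzRingType) (a b c d a' b' c' d' : R) :
  mx22 a b c d *m mx22 a' b' c' d' =
  mx22 (a * a' + b * c') (a * b' + b * d') (c * a' + d * c') (c * b' + d * d').
Proof.
rewrite [LHS]mx22E; congr mx22; by rewrite !mxE !big_ord_recl big_ord0 !mxE /= addr0.
Qed.

Lemma det_mx22 (R : comNzRingType) (a b c d : R) : \det (mx22 a b c d) = a * d - b * c.
Proof.
rewrite (expand_det_row _ ord0) !big_ord_recl big_ord0 addr0 /cofactor.
rewrite !det_mx11 !mxE /= !expr0 !expr1; ring.
Qed.

Definition gl a b c d : GL2 K := toGL2 (mx22 a b c d).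

Lemma val_gl a b c d : a * d - b * c != 0 -> val (gl a b c d) = mx22 a b c d.
Proof.
move=> D; rewrite val_insubd /=; case: ifP => // /negP[].
by rewrite unitmxE det_mx22 unitfE.
Qed.

Lemma val_mulGL (g h : GL2 K) : val (g * h)%g = val g *m val h.
Proof. by []. Qed.

Lemma det_GL2 (g : GL2 K) :
  val g 0 0 * val g 1 1 - val g 0 1 * val g 1 0 != 0.
Proof.
have : val g \in unitmx := unit_valP g.
by rewrite unitmxE unitfE {1}[val g]mx22E det_mx22.
Qed.

Lemma gl_eta (g : GL2 K) : g = gl (val g 0 0) (val g 0 1) (val g 1 0) (val g 1 1).
Proof. by apply: val_inj; rewrite val_gl ?det_GL2 // -mx22E. Qed.

Lemma mul_gl a b c d a' b' c' d' :
  a * d - b * c != 0 -> a' * d' - b' * c' != 0 ->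
  (gl a b c d * gl a' b' c' d')%g =
  gl (a * a' + b * c') (a * b' + b * d') (c * a' + d * c') (c * b' + d * d').
Proof.
move=> D D'; apply: val_inj; rewrite val_mulGL !val_gl //; first by rewrite mulmx22.
suff -> : (a * a' + b * c') * (c * b' + d * d') - (a * b' + b * d') * (c * a' + d * c')
  = (a * d - b * c) * (a' * d' - b' * c') by rewrite mulf_neq0.
by ring.
Qed.

Lemma gl1 : gl 1 0 0 1 = 1%g.
Proof.
apply: val_inj; rewrite val_gl ?mulr1 ?mul0r ?subr0 ?oner_neq0 //.
by rewrite [RHS]mx22E !mxE.
Qed.

Definition upper a b := gl a b 0 1.
Definition scal a := gl a 0 0 a.
Definition weyl := gl 0 1 1 0.

Lemma det_upper_neq0 a b : a != 0 -> a * 1 - b * 0 != 0.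
Proof. by rewrite mulr1 mulr0 subr0. Qed.

Lemma mul_upper a b a' b' : a != 0 -> a' != 0 ->
  (upper a b * upper a' b')%g = upper (a * a') (a * b' + b).
Proof. by move=> a0 b0; rewrite mul_gl ?det_upper_neq0 //; congr gl; ring. Qed.

Lemma det_weyl_neq0 : 0 * 0 - 1 * 1 != 0 :> K.
Proof. by rewrite mulr0 mulr1 sub0r oppr_eq0 oner_neq0. Qed.

Lemma det_diag_neq0 a d : a != 0 -> d != 0 -> a * d - 0 * 0 != 0.
Proof. by move=> a0 d0; rewrite mulr0 subr0 mulf_neq0. Qed.

Lemma weyl2 : (weyl * weyl)%g = 1%g.
Proof. by rewrite mul_gl ?det_weyl_neq0 // -gl1; congr gl; ring. Qed.

Lemma weyl_diag a : a != 0 -> (weyl * upper a 0 * weyl)%g = gl 1 0 0 a.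
Proof.
move=> a0; rewrite mul_gl ?det_weyl_neq0 ?det_upper_neq0 // mul_gl ?det_weyl_neq0 //; last first.
  suff -> : (0 * a + 1 * 0) * (1 * 0 + 0 * 1) - (0 * 0 + 1 * 1) * (1 * a + 0 * 0) = - a.
    by rewrite oppr_eq0.
  by ring.
by congr gl; ring.
Qed.

Lemma upper_diag a b d : a != 0 -> d != 0 ->
  (upper a b * gl 1 0 0 d)%g = (upper (a / d) b * scal d)%g.
Proof.
move=> a0 d0; rewrite !mul_gl ?det_upper_neq0 ?det_diag_neq0 ?oner_neq0 ?mulf_neq0 ?invr_eq0 //.
by congr gl; field.
Qed.

Lemma upper1 : upper 1 0 = 1%g. Proof. exact: gl1. Qed.

Lemma upperV a b : a != 0 -> (upper a b)^-1%g = upper a^-1 (- (b / a)).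
Proof.
move=> a0; apply: (mulgI (upper a b)); rewrite mulgV mul_upper ?invr_eq0 //.
by rewrite -gl1; congr gl; field.
Qed.

Lemma scal_commute z (g : GL2 K) : z != 0 -> commute (scal z) g.
Proof.
move=> z0; apply: val_inj; rewrite !val_mulGL [val g]mx22E val_gl ?det_diag_neq0 //.
by rewrite !mulmx22; congr mx22; ring.
Qed.

(** Commuting with the two elementary unipotent matrices is enough. *)
Lemma center_scal (g : GL2 K) :
  (forall h : GL2 K, commute g h) -> exists2 z, z != 0 & g = scal z.
Proof.
move=> gZ; have D := det_GL2 g; rewrite [g]gl_eta in gZ *.
move: (val g 0 0) (val g 0 1) (val g 1 0) (val g 1 1) D gZ => a b c d D gZ.
have U : (1 * 1 - 1 * 0 != 0 :> K) by rewrite mulr0 subr0 mulr1 oner_neq0.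
have L : (1 * 1 - 0 * 1 != 0 :> K) by rewrite mul0r subr0 mulr1 oner_neq0.
have /(congr1 val) := gZ (gl 1 1 0 1).
rewrite !val_mulGL !val_gl // !mulmx22 !(mulr1, mulr0, mul1r, mul0r, add0r, addr0).
move=> E; have [E1 E2 _ _] := mx22_inj E.
have /(congr1 val) := gZ (gl 1 0 1 1).
rewrite !val_mulGL !val_gl // !mulmx22 !(mulr1, mulr0, mul1r, mul0r, add0r, addr0).
move=> {}E; have [E3 _ _ _] := mx22_inj E.
have c0 : c = 0 by apply: (addrI a); rewrite -E1 addr0.
have b0 : b = 0 by apply: (addrI a); rewrite E3 addr0.
have da : d = a by apply: (addrI b); rewrite -E2 addrC.
exists a; last by rewrite c0 b0 da.
by apply: contraNneq D => a0; rewrite c0 a0 mul0r mulr0 subr0.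
Qed.

Lemma weyl_gl a b c d : a * d - b * c != 0 -> (weyl * gl a b c d)%g = gl c d a b.
Proof. by move=> D; rewrite mul_gl ?det_weyl_neq0 //; congr gl; ring. Qed.

Lemma gl_weyl a b c d : a * d - b * c != 0 -> (gl a b c d * weyl)%g = gl b a d c.
Proof. by move=> D; rewrite mul_gl ?det_weyl_neq0 //; congr gl; ring. Qed.

Lemma upperV_weyl a : a != 0 ->
  (upper a 0)^-1%g = (weyl * upper a 0 * (weyl * scal a^-1))%g.
Proof.
move=> a0; rewrite mulgA weyl_diag // upperV // mul_gl ?det_diag_neq0 ?oner_neq0 ?invr_eq0 //.
by congr gl; field.
Qed.

(** The factorisation behind the Cartan decomposition: when the last entry [d]
    divides all others, the triangular factors are integral. *)
Lemma LDU_gl a b c d u w : d != 0 -> u != 0 -> w != 0 ->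
  gl ((w * u + b * c) * d) (b * d) (c * d) d =
  (scal d * upper 1 b * upper w 0 * (upper u 0 * gl 1 0 c 1))%g.
Proof.
move=> d0 u0 w0; have L : 1 * 1 - 0 * c != 0 by rewrite mul0r subr0 mulr1 oner_neq0.
apply: val_inj; rewrite !val_mulGL !val_gl ?det_diag_neq0 ?det_upper_neq0 ?oner_neq0 //.
  by rewrite !mulmx22; congr mx22; ring.
suff -> : (w * u + b * c) * d * d - b * d * (c * d) = w * u * (d * d).
  by rewrite !mulf_neq0.
by ring.
Qed.

(** The consequences of a relation between two Cartan representatives from which
    the equality of their levels follows; they come from the determinants and the
    last entries. *)
Lemma KAK_diag (z z' a b c d a' b' c' d' P Q : K) :
  a * d - b * c != 0 -> a' * d' - b' * c' != 0 -> P != 0 -> Q != 0 -> z != 0 -> z' != 0 ->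
  upper P 0 = (scal z * gl a b c d * upper Q 0 * (scal z' * gl a' b' c' d'))%g ->
  P = (z * z') ^+ 2 * (a * d - b * c) * (a' * d' - b' * c') * Q /\
  1 = z * z' * (c * b' * Q + d * d').
Proof.
move=> D D' P0 Q0 z0 z'0 /(congr1 val).
rewrite -!mulgA !val_mulGL !val_gl ?det_diag_neq0 ?det_upper_neq0 // => E.
move: (congr1 determinant E); rewrite !det_mulmx !det_mx22 => E1.
rewrite !mulmx22 in E; have [_ _ _ E2] := mx22_inj E.
split; last by rewrite E2; ring.
by rewrite mulr1 mulr0 subr0 in E1; rewrite E1; ring.
Qed.

(** The matrices [upper P t] and [gl 1 0 0 P] represent the neighbours of the
    base vertex. An element of [KZ] moves the vertex of [upper P 0] to the first kind
    when its last entry [d] is a unit, with [t] congruent modulo [P] to the ratio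
    of the entries of its last column, and to the second kind when its last entry
    is a multiple of [P]. *)
Lemma mul_diag_upper P t z a c d s : P != 0 -> z != 0 ->
  a * d - (d * t + P * s * d) * c != 0 ->
  (scal z * gl a (d * t + P * s * d) c d * upper P 0)%g =
  (upper P t * (scal z * gl (a - t * c) (s * d) (P * c) d))%g.
Proof.
move=> P0 z0 D; apply: val_inj; rewrite !val_mulGL !val_gl ?det_diag_neq0 ?det_upper_neq0 //.
  by rewrite !mulmx22; congr mx22; ring.
by apply: contraNneq D => <-; apply/eqP; ring.
Qed.

Lemma mul_diag_lower P z a b c d : P != 0 -> z != 0 -> a * (P * d) - b * c != 0 ->
  (scal z * gl a b c (P * d) * upper P 0)%g =
  (gl 1 0 0 P * (scal z * gl (P * a) b c d))%g.
Proof.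
move=> P0 z0 D; apply: val_inj; rewrite !val_mulGL !val_gl ?det_diag_neq0 ?det_upper_neq0 //.
  by rewrite !mulmx22; congr mx22; ring.
by apply: contraNneq D => <-; apply/eqP; ring.
Qed.

(** The matrices [weyl] and 1 send the vertex of [upper P 1] to the same
    vertex. *)
Lemma weyl_upper1 P : P != 0 ->
  (weyl * upper P 1)%g = (upper P 1 * gl (-1) 0 P 1)%g.
Proof.
move=> P0; rewrite mul_gl ?det_weyl_neq0 ?det_upper_neq0 // mul_gl ?det_upper_neq0 //.
  by congr gl; ring.
by rewrite mul0r subr0 mulr1 oppr_eq0.
Qed.

End Matrices.

(** * Levels of vertices *)

Section Tree.
Variables (K : fieldType) (O : comUnitRingType) (v : {rmorphism O -> K}).
Variables (varpi : O) (KZ : groupClosed (GL2 K)).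

(** What the geometry of the tree needs: [O] is a discrete valuation ring with
    uniformizer [varpi], embedded by [v] in its fraction field, and [KZ] is the
    subgroup generated by the scalars and the invertible matrices over [O]. *)
Record dvr_lattices : Prop := DvrLattices {
  dvr_inj : injective v;
  dvr_varpi0 : varpi != 0;
  dvr_nonunit : forall x, x \isn't a GRing.unit <-> exists y, x = varpi * y;
  dvr_factor : forall x, x != 0 ->
    exists2 u, u \is a GRing.unit & exists n, x = u * varpi ^+ n;
  dvr_total : forall x : K, x != 0 ->
    (exists a, x = v a) \/ (exists a, x^-1 = v a);
  dvr_KZ : forall g, g \in KZ <-> exists (z : K) (a b c d : O), [/\ z != 0,
    a * d - b * c \is a GRing.unit & g = (scal z * gl (v a) (v b) (v c) (v d))%g] }.

Hypothesis V : dvr_lattices.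

Lemma v_eq0 x : (v x == 0) = (x == 0).
Proof. by rewrite -(rmorph0 v) (inj_eq (dvr_inj V)). Qed.

Lemma v_unit (u : O) : u \is a GRing.unit -> v u != 0.
Proof. by rewrite v_eq0; apply: contraTneq => ->; rewrite unitr0. Qed.

Lemma varpi_unitN : varpi \isn't a GRing.unit.
Proof. by apply/(dvr_nonunit V); exists 1; rewrite mulr1. Qed.

Let wn n : v varpi ^+ n != 0.
Proof. by rewrite expf_neq0 // v_eq0 (dvr_varpi0 V). Qed.

Lemma KZ_gl (a b c d : O) : a * d - b * c \is a GRing.unit ->
  gl (v a) (v b) (v c) (v d) \in KZ.
Proof.
move=> D; apply/(dvr_KZ V); exists 1, a, b, c, d; split=> //.
by rewrite -[scal 1]/(gl 1 0 0 1) gl1 mul1g.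
Qed.

Lemma KZ_scal z : z != 0 -> scal z \in KZ.
Proof.
move=> z0; apply/(dvr_KZ V); exists z, 1, 0, 0, 1.
by rewrite mulr1 mulr0 subr0 unitr1 rmorph1 rmorph0 gl1 mulg1.
Qed.

Lemma KZ_weyl : weyl K \in KZ.
Proof.
have := @KZ_gl 0 1 1 0; rewrite rmorph0 rmorph1; apply.
by rewrite mulr0 mulr1 sub0r unitrN unitr1.
Qed.

Lemma KZ_upper (a b : O) : a \is a GRing.unit -> upper (v a) (v b) \in KZ.
Proof.
move=> aU; have := @KZ_gl a b 0 1; rewrite rmorph0 rmorph1; apply.
by rewrite mulr0 mulr1 subr0.
Qed.

Lemma KZ_upper1 (b : O) : upper 1 (v b) \in KZ.
Proof. by rewrite -(rmorph1 v) KZ_upper // unitr1. Qed.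

Definition diag n : GL2 K := upper (v varpi ^+ n) 0.

Lemma diagD m n : (diag m * diag n)%g = diag (m + n).
Proof. by rewrite /diag mul_upper ?wn // exprD mulr0 addr0. Qed.

Lemma diag0 : diag 0 = 1%g. Proof. exact: upper1. Qed.

Lemma diag_upper n a b : a != 0 ->
  (diag n * upper a b)%g = (upper a (v varpi ^+ n * b) * diag n)%g.
Proof. by move=> a0; rewrite /diag !mul_upper ?wn //; congr gl; ring. Qed.

Definition at_level n (g : GL2 K) :=
  exists x y, [/\ x \in KZ, y \in KZ & g = (x * diag n * y)%g].

Lemma at_level_KZ n g x y : x \in KZ -> y \in KZ ->
  at_level n g -> at_level n (x * g * y)%g.
Proof.
move=> xK yK [x' [y' [x'K y'K ->]]]; exists (x * x')%g, (y' * y)%g.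
by split; rewrite ?gpredM // !mulgA.
Qed.

(** Write [diag m] as [z k diag(varpi^n, 1) k'] with [z] scalar and [k], [k']
    integral. The last entry gives that [z^-1] is an integer [t], and the
    determinant that [varpi^m t^2] is a unit times [varpi^n]. *)
Lemma diag_inj_le m n x y : x \in KZ -> y \in KZ ->
  diag m = (x * diag n * y)%g -> (m <= n)%N.
Proof.
move=> /(dvr_KZ V)[z [a [b [c [d [z0 D ->]]]]]].
move=> /(dvr_KZ V)[z' [a' [b' [c' [d' [z'0 D' ->]]]]]] /KAK_diag[].
- by rewrite -!rmorphM -rmorphB v_unit.
- by rewrite -!rmorphM -rmorphB v_unit.
- exact: wn.
- exact: wn.
- exact: z0.
- exact: z'0.
move=> E1 E2.
pose t := c * b' * varpi ^+ n + d * d'.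
pose s := (a * d - b * c) * (a' * d' - b' * c').
have sU : s \is a GRing.unit by rewrite unitrM D D'.
have tE : 1 = z * z' * v t.
  by rewrite E2 /t rmorphD !(rmorphM v) (rmorphXn v).
have wE : varpi ^+ m * t ^+ 2 = s * varpi ^+ n.
  apply: (dvr_inj V); rewrite 2!(rmorphM v) !(rmorphXn v) E1.
  transitivity (v s * v varpi ^+ n * (z * z' * v t) ^+ 2); last first.
    by rewrite -tE expr1n mulr1.
  by rewrite /s !(rmorphM v) !(rmorphB v) !(rmorphM v); ring.
rewrite leqNgt; apply/negP => nm.
case/negP: varpi_unitN.
have {}wE : varpi ^+ (m - n) * t ^+ 2 = s.
  apply/(dvr_inj V)/(mulIf (wn n)).
  rewrite -rmorphXn -!rmorphM -wE mulrAC -exprD subnK //.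
  exact: ltnW.
move: sU; rewrite -wE unitrM => /andP[wU _].
by rewrite -(unitrX_pos _ (_ : 0 < m - n)%N) // subn_gt0.
Qed.

Lemma at_level_inj m n g : at_level m g -> at_level n g -> m = n.
Proof.
suff le m' n' : at_level m' g -> at_level n' g -> (m' <= n')%N.
  by move=> Hm Hn; apply/eqP; rewrite eqn_leq !le.
move=> [x [y [xK yK ->]]] [x' [y' [x'K y'K E]]].
apply: (@diag_inj_le _ _ (x^-1 * x')%g (y' * y^-1)%g).
- by rewrite gpredM ?gpredV.
- by rewrite gpredM ?gpredV.
- by rewrite -[LHS](mulKg x) -(mulgK y (x * diag m')%g) E !mulgA.
Qed.

Definition fdvd (x y : K) := exists t : O, y = v t * x.

Lemma fdvd_total x y : fdvd x y \/ fdvd y x.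
Proof.
have [->|x0] := eqVneq x 0; first by right; exists 0; rewrite rmorph0 mul0r.
have [->|y0] := eqVneq y 0; first by left; exists 0; rewrite rmorph0 mul0r.
have [|[t tE]|[t tE]] := dvr_total V (x := y / x).
- by rewrite mulf_neq0 ?invr_eq0.
- by left; exists t; rewrite -tE divfK.
- by right; exists t; rewrite -tE invf_div divfK.
Qed.

Lemma fdvd_trans x y z : fdvd x y -> fdvd y z -> fdvd x z.
Proof. by move=> [t ->] [s ->]; exists (s * t); rewrite rmorphM mulrA. Qed.

Lemma fdvd_pair x y : exists2 z, z = x \/ z = y & fdvd z x /\ fdvd z y.
Proof.
have fdvdxx z : fdvd z z by exists 1; rewrite rmorph1 mul1r.
by case: (fdvd_total x y); [exists x|exists y]; auto.
Qed.

Lemma at_level_gl a b c d : a * d - b * c != 0 ->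
  fdvd d a -> fdvd d b -> fdvd d c -> exists n, at_level n (gl a b c d).
Proof.
move=> D [a' aE] [b' bE] [c' cE]; rewrite {}aE {}bE {}cE in D *.
have d0 : d != 0 by apply: contraNneq D => ->; rewrite !mulr0 subr0.
have [|u uU [n uE]] := dvr_factor V (x := a' - b' * c').
  apply: contraNneq D => D'; have := congr1 v D'; rewrite rmorph0 rmorphB rmorphM => {}D'.
  suff -> : v a' * d * d - v b' * d * (v c' * d) = d * d * (v a' - v b' * v c').
    by rewrite D' mulr0.
  by ring.
exists n, (scal d * upper 1 (v b'))%g, (upper (v u) 0 * gl 1 0 (v c') 1)%g; split.
- by rewrite gpredM ?KZ_scal // KZ_upper1.
- rewrite gpredM //; first by rewrite -(rmorph0 v) KZ_upper.
  by rewrite -(rmorph0 v) -(rmorph1 v) KZ_gl // mulr1 mul0r subr0 unitr1.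
have vuE : v a' = v varpi ^+ n * v u + v b' * v c'.
  by rewrite -rmorphXn -!rmorphM -rmorphD mulrC -uE addrNK.
by rewrite vuE LDU_gl ?v_unit ?wn.
Qed.

(** Some entry divides all the others; multiplying on both sides by the Weyl
    element moves it to the last position. *)
Lemma at_level_ex g : exists n, at_level n g.
Proof.
rewrite [g]gl_eta; have D := det_GL2 g.
move: (val g 0 0) (val g 0 1) (val g 1 0) (val g 1 1) D => {g} a b c d D.
have [x xE [xa xb]] := fdvd_pair a b; have [y yE [yc yd]] := fdvd_pair c d.
have [z zE [zx zy]] := fdvd_pair x y.
have {zx} [za zb] := (fdvd_trans zx xa, fdvd_trans zx xb).
have {zy} [zc zd] := (fdvd_trans zy yc, fdvd_trans zy yd).
have {xE yE zE} : z = a \/ z = b \/ z = c \/ z = d.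
  by case: zE => ->; [case: xE => ->|case: yE => ->]; auto.
have W := KZ_weyl; have KZ1 : 1%g \in KZ := gpred1.
have D1 : d * a - c * b != 0 by rewrite [d * a]mulrC [c * b]mulrC.
have D2 : c * b - d * a != 0 by rewrite -opprB oppr_eq0.
have D3 : b * c - a * d != 0 by rewrite -opprB oppr_eq0.
case=> [|[|[|]]] E; rewrite {}E in za zb zc zd.
- have [n An] := at_level_gl D1 zd zc zb; exists n.
  by have := at_level_KZ W W An; rewrite weyl_gl // gl_weyl.
- have [n An] := at_level_gl D2 zc zd za; exists n.
  by have := at_level_KZ W KZ1 An; rewrite mulg1 weyl_gl.
- have [n An] := at_level_gl D3 zb za zd; exists n.
  by have := at_level_KZ KZ1 W An; rewrite mul1g gl_weyl.
- exact: at_level_gl.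
Qed.

Definition level g : nat := sval (cid (at_level_ex g)).

Lemma level_at g : at_level (level g) g.
Proof. exact: svalP (cid (at_level_ex g)). Qed.

Lemma levelE n g : at_level n g -> level g = n.
Proof. by apply: at_level_inj; apply: level_at. Qed.

Lemma level_KZ x g y : x \in KZ -> y \in KZ -> level (x * g * y)%g = level g.
Proof. by move=> xK yK; apply: levelE; apply: at_level_KZ => //; apply: level_at. Qed.

Lemma level_KZl x g : x \in KZ -> level (x * g)%g = level g.
Proof. by move=> xK; rewrite -(mulg1 (x * g)%g) level_KZ // gpred1. Qed.

Lemma level_KZr g y : y \in KZ -> level (g * y)%g = level g.
Proof. by move=> yK; rewrite -[(g * y)%g]mul1g mulgA level_KZ // gpred1. Qed.

Lemma level_diag n : level (diag n) = n.
Proof.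
apply: levelE; exists 1%g, 1%g.
by split; [exact: gpred1|exact: gpred1|rewrite mul1g mulg1].
Qed.

Lemma level0 g : level g = 0%N -> g \in KZ.
Proof.
move=> g0; have := level_at g; rewrite g0 => -[x [y [xK yK ->]]].
by rewrite diag0 mulg1 gpredM.
Qed.

Lemma levelV g : level g^-1%g = level g.
Proof.
have [x [y [xK yK gE]]] := level_at g; move: (level g) gE => n ->.
rewrite !invgM mulgA level_KZ ?gpredV //.
suff -> : (diag n)^-1%g = (weyl K * diag n * (weyl K * scal (v varpi ^- n)))%g.
  by rewrite level_KZ ?level_diag ?gpredM ?KZ_weyl ?KZ_scal ?invr_eq0.
by rewrite /diag upperV_weyl.
Qed.

(** * Neighbours of a vertex *)

Variables (k : finFieldType) (red : {rmorphism O -> k}) (teich : k -> O).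
Hypothesis red0 : forall x, red x = 0 <-> exists y, x = varpi * y.
Hypothesis teichK : cancel teich red.
Hypothesis k_gt2 : (2 < #|k|)%N.

Lemma red_unit (x : O) : (x \is a GRing.unit) = (red x != 0).
Proof.
apply/idP/idP => [xU|]; last by apply: contraNT => /(dvr_nonunit V)/red0 ->.
by apply/negP => /eqP/red0/(dvr_nonunit V); rewrite xU.
Qed.

Lemma unit_sub1 : exists2 a : O, a \is a GRing.unit & a - 1 \is a GRing.unit.
Proof.
have : (0 < #|~: [set 0%R; 1%R : k]|)%N.
  rewrite -(ltn_add2l #|[set 0%R; 1%R : k]|) cardsC addn0 cards2.
  by apply: leq_ltn_trans k_gt2; case: (_ == _).
case/card_gt0P => y; rewrite !inE negb_or => /andP[y0 y1].
exists (teich y); first by rewrite red_unit teichK.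
by rewrite red_unit rmorphB rmorph1 teichK subr_eq0.
Qed.

(** The vertex of [child b] depends only on the residue class of [b]; allowing
    every [b] in [O] lets affine maps act on the labels. *)
Definition child (b : O) : GL2 K := upper (v varpi) (v b).
(** Translated by [diag n.+1], the neighbours [Some x] become the children of a
    vertex and [None] its parent. *)
Definition nbr (i : option k) : GL2 K :=
  if i is Some x then child (teich x) else gl 1 0 0 (v varpi).

Let w0 : v varpi != 0 := wn 1.

Lemma nbr_cover x : x \in KZ ->
  exists i y, y \in KZ /\ (x * diag 1)%g = (nbr i * y)%g.
Proof.
case/(dvr_KZ V) => z [a [b [c [d [z0 D ->]]]]]; rewrite /diag expr1.
have Dv : v a * v d - v b * v c != 0 by rewrite -!rmorphM -rmorphB v_unit.
have [dU|/(dvr_nonunit V)[d' dE]] := boolP (d \is a GRing.unit).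
  pose t := teich (red (b / d)).
  have [s sE] : exists s, b / d - t = varpi * s.
    by apply/red0; rewrite rmorphB teichK subrr.
  have bE : b = d * t + varpi * s * d.
    by rewrite -sE mulrBl divrK // addrC [d * t]mulrC subrK.
  exists (Some (red (b / d))).
  exists (scal z * gl (v (a - t * c)%R) (v (s * d)%R) (v (varpi * c)%R) (v d))%g; split.
    rewrite gpredM ?KZ_scal ?KZ_gl //.
    by move: D; rewrite bE; congr (is_true (_ \is a _)); ring.
  have vbE : v b = v d * v t + v varpi * v s * v d.
    by rewrite bE (rmorphD v) !(rmorphM v).
  rewrite (rmorphB v) !(rmorphM v) vbE; apply: mul_diag_upper => //.
  by rewrite -vbE.
exists None, (scal z * gl (v (varpi * a)%R) (v b) (v c) (v d'))%g; split.
  rewrite gpredM ?KZ_scal ?KZ_gl //.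
  by move: D; rewrite dE; congr (is_true (_ \is a _)); ring.
by rewrite dE !(rmorphM v); apply: mul_diag_lower => //; rewrite -rmorphM -dE.
Qed.

Lemma childE b : child b = (upper 1 (v b) * diag 1)%g.
Proof. by rewrite mul_upper ?oner_neq0 // expr1 mul1r mulr0 add0r. Qed.

Lemma diag_child n b :
  (diag n * child b)%g = (upper 1 (v (varpi ^+ n * b)%R) * diag n.+1)%g.
Proof.
by rewrite childE mulgA diag_upper ?oner_neq0 // -mulgA diagD addn1 rmorphM rmorphXn.
Qed.

Lemma diag_nbrN n : (diag n.+1 * nbr None)%g = (diag n * scal (v varpi))%g.
Proof. by rewrite upper_diag // exprSr mulfK. Qed.

Lemma nbrNE : nbr None = (weyl K * diag 1 * weyl K)%g.
Proof. by rewrite weyl_diag ?expr1. Qed.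

Lemma level_nbr i : level (nbr i) = 1%N.
Proof.
case: i => [t|]; first by rewrite [nbr _]childE level_KZl ?KZ_upper1 // level_diag.
by rewrite nbrNE level_KZ ?KZ_weyl // level_diag.
Qed.

(** The bottom row [(0, 1)] forces the scalar part to be the inverse of a unit
    of [O]. *)
Lemma KZ_unipotent b : upper 1 b \in KZ -> exists c, b = v c.
Proof.
case/(dvr_KZ V) => z [a' [b' [c' [d' [z0 D]]]]].
have Dv : v a' * v d' - v b' * v c' != 0 by rewrite -!rmorphM -rmorphB v_unit.
move=> /(congr1 val); rewrite val_mulGL !val_gl ?det_diag_neq0 ?det_upper_neq0 // mulmx22 => E.
have [_ bE cE dE] := mx22_inj E.
have zd : z * v d' = 1 by rewrite dE mul0r add0r.
have c0 : c' = 0.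
  by apply/eqP; rewrite -v_eq0 -(mulrI_eq0 _ (mulfI z0)) cE mul0r add0r.
have dU : d' \is a GRing.unit.
  by move: D; rewrite c0 mulr0 subr0 unitrM => /andP[].
exists (b' / d'); rewrite bE mul0r addr0 (rmorphM v) (rmorphV v) // mulrC.
by congr (_ * _); rewrite -[RHS]mul1r -zd mulfK // v_unit.
Qed.

(** Translating by [diag 1] separates [None] from the others by their levels 0
    and 2; two labels [t] and [s] in the same coset are congruent by
    [KZ_unipotent]. *)
Lemma nbr_inj i j : ((nbr i)^-1 * nbr j)%g \in KZ -> i = j.
Proof.
have NS t y : y \in KZ -> nbr (Some t) = (nbr None * y)%g -> False.
  move=> yK /(congr1 (fun h => level (diag 1 * h)%g)).
  rewrite mulgA (level_KZr _ yK) diag_nbrN (level_KZr _ (KZ_scal w0)) level_diag.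
  by rewrite [nbr _]/(child _) diag_child level_KZl ?KZ_upper1 // level_diag.
case: i j => [t|] [s|] // H.
- have [c] : exists c, (v (teich s) - v (teich t)) / v varpi = v c.
    apply: KZ_unipotent; move: H; rewrite /= /child upperV // mul_upper ?invr_eq0 //.
    by rewrite mulVf // mulrBl mulrC.
  move/(canRL (divfK w0)); rewrite -rmorphB -rmorphM => /(dvr_inj V) E.
  congr Some; apply/eqP; rewrite -(teichK t) -(teichK s) eq_sym -subr_eq0 -rmorphB.
  by apply/eqP/red0; exists c; rewrite E mulrC.
- by case: (NS t ((nbr None)^-1 * nbr (Some t))%g); rewrite ?mulVKg // -gpredV invgM invgK.
- by case: (NS s _ H); rewrite mulVKg.
Qed.

(** * The Hecke operator *)

Variables (C : fieldType) (T : {linear cind C KZ -> cind C KZ}).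
Hypothesis TP : forall g, T (cind_basis C KZ g) =
  \sum_(x : k) cind_basis C KZ (g * nbr (Some x))%g + cind_basis C KZ (g * nbr None)%g.
Local Notation V0 := (cind C KZ).

Lemma cind_right (f : V0) g y : y \in KZ -> f (g * y)%g = f g.
Proof. by move=> yK; have /asboolP[fH _] := cind_funP f; apply: fH. Qed.

Lemma cind_coset (f : V0) g h : (g^-1 * h)%g \in KZ -> f h = f g.
Proof. by move=> yK; rewrite -(cind_right f g yK) mulVKg. Qed.

Lemma cindD (f f' : V0) g : (f + f') g = f g + f' g. Proof. by []. Qed.
Lemma cindB (f f' : V0) g : (f - f') g = f g - f' g. Proof. by []. Qed.
Lemma cindZ c (f : V0) g : (c *: f) g = c * f g. Proof. by []. Qed.
Lemma cind0 g : (0 : V0) g = 0. Proof. by []. Qed.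
Lemma cind_sum (I : Type) (r : seq I) (P : pred I) (F : I -> V0) g :
  (\sum_(i <- r | P i) F i) g = \sum_(i <- r | P i) F i g.
Proof. by elim/big_rec2: _ => // i x y _ <-. Qed.

Lemma cind_ind (P : V0 -> Prop) : P 0 ->
  (forall c g f, P f -> P (c *: cind_basis C KZ g + f)) -> forall f, P f.
Proof.
move=> P0 PS f; have /asboolP[_ [s]] := cind_funP f.
elim: s f => [|x s IH] f fs.
  suff -> : f = 0 by [].
  apply/val_inj/funext => g; apply/eqP; rewrite -[_ == _]negbK; apply/negP.
  by move/fs.
rewrite -(subrK ((f x : C) *: cind_basis C KZ x) f) addrC; apply/PS/IH => g.
rewrite cindB cindZ /=; have [xg|xg] := boolP (_ \in KZ).
  by rewrite (cind_coset f xg) mulr1 subrr eqxx.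
by rewrite mulr0 subr0 => /fs /=; rewrite (negPf xg).
Qed.

Lemma big_option (W : nmodType) (E : option k -> W) :
  \sum_i E i = E None + \sum_x E (Some x).
Proof.
rewrite (bigD1 None) //=; congr (_ + _).
rewrite (reindex_omap Some id) => [|[i|]] //=.
by apply: eq_bigl => x; rewrite eqxx.
Qed.

(** The cosets of the [nbr i] partition the elements of level 1, so that each of
    these is counted once. *)
Lemma nbr_count (y : GL2 K) :
  \sum_i (((nbr i)^-1 * y)%g \in KZ)%:R = (level y == 1%N)%:R :> C.
Proof.
have [y1|y1] := eqVneq.
  have [x [z [xK zK yE]]] := level_at y; rewrite y1 in yE.
  have [i [x' [x'K E]]] := nbr_cover xK; rewrite yE E.
  rewrite (bigD1 i) //= -!mulgA mulKg gpredM // big1 ?addr0 // => j /negP ij.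
  case: (boolP (_ \in KZ)) => // H; case: ij; apply/eqP/nbr_inj.
  by move: H; rewrite !mulgA gpredMr // gpredMr.
apply: big1 => i _; case: (boolP (_ \in KZ)) => // H.
by case/eqP: y1; rewrite -(level_nbr i) -(mulVKg (nbr i) y) level_KZr.
Qed.

(** On a basis vector [[h,1]] the two sides ask whether [h^-1 g], respectively
    its inverse, has level 1: this is the symmetry of the relation of being
    neighbours ([levelV]). *)
Lemma hecke_eval (f : V0) g : T f g = \sum_i f (g * nbr i)%g.
Proof.
elim/cind_ind: f => [|c h f IH]; first by rewrite linear0 big1.
rewrite linearP cindD cindZ IH.
under [RHS]eq_bigr => i _ do rewrite cindD cindZ /=.
rewrite big_split -mulr_sumr; congr (_ * _ + _).
transitivity (\sum_i cind_basis C KZ (h * nbr i)%g g).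
  by rewrite TP cindD cind_sum big_option addrC.
rewrite /=; under eq_bigr => i _ do rewrite invgM -mulgA.
rewrite nbr_count -levelV -nbr_count; apply: eq_bigr => i _.
by rewrite -gpredV !invgM !invgK mulgA.
Qed.

Definition vanish (f : V0) n := forall g, (n <= level g)%N -> f g = 0.

Lemma hecke_diag (f : V0) x m : T f (x * diag m.+1)%g =
  f (x * diag m)%g + \sum_t f (x * diag m.+1 * child (teich t))%g.
Proof.
rewrite hecke_eval big_option; congr (_ + _).
by rewrite -mulgA diag_nbrN mulgA cind_right ?KZ_scal.
Qed.

Lemma diag_child_KZ x n b : x \in KZ -> exists2 y, y \in KZ &
  (x * diag n * child b)%g = (y * diag n.+1)%g.
Proof.
move=> xK; exists (x * upper 1 (v (varpi ^+ n * b)%R))%g; first by rewrite gpredM ?KZ_upper1.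
by rewrite -mulgA diag_child mulgA.
Qed.

Lemma level_KZdiag x n : x \in KZ -> level (x * diag n)%g = n.
Proof. by move=> xK; rewrite level_KZl // level_diag. Qed.

Lemma hecke_top (f : V0) x m : x \in KZ -> vanish f m.+2 ->
  T f (x * diag m.+1)%g = f (x * diag m)%g.
Proof.
move=> xK f0; rewrite hecke_diag big1 ?addr0 // => t _; apply: f0.
by have [y yK ->] := diag_child_KZ m.+1 (teich t) xK; rewrite level_KZdiag.
Qed.

Lemma vanishW f m n : (m <= n)%N -> vanish f m -> vanish f n.
Proof. by move=> mn f0 g gn; apply/f0/(leq_trans mn). Qed.

Lemma vanish_hecke f n : vanish f n -> vanish (T f) n.+1.
Proof.
move=> f0 g; have [x [y [xK yK gE]]] := level_at g.
move: (level g) gE => [//|m] ->; rewrite ltnS cind_right // => nm.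
rewrite hecke_diag f0 ?level_KZdiag // add0r big1 // => t _; apply: f0.
have [z zK ->] := diag_child_KZ m.+1 (teich t) xK; rewrite level_KZdiag //.
exact: leq_trans nm (leq_trans (leqnSn _) (leqnSn _)).
Qed.

Lemma vanish_ex f : exists n, vanish f n.
Proof.
have /asboolP[_ [s fs]] := cind_funP f.
exists (\max_(x <- s) level x).+1 => g gs; apply/eqP.
rewrite -[_ == _]negbK; apply/negP => /fs/hasP[x xs /= xg].
move: gs; rewrite -(mulVKg x g) level_KZr // ltnNge => /negP[].
exact: leq_bigmax_seq.
Qed.

(** The topmost nonzero value of [f] reappears one level higher in [T f]. *)
Lemma vanish_of_hecke f n : vanish (T f) n.+1 -> vanish f n.
Proof.
move=> Tf0; have [N fN] := vanish_ex f.
have {fN} : vanish f (n + N) by apply: vanishW fN; apply: leq_addl.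
elim: N => [|N IH]; first by rewrite addn0.
rewrite addnS => f0; apply: IH => g; rewrite leq_eqVlt => /orP[/eqP gn|]; last exact: f0.
have [x [y [xK yK ->]]] := level_at g; rewrite -gn cind_right // -hecke_top //.
  by rewrite Tf0 // level_KZdiag // ltnS leq_addr.
exact: vanishW f0.
Qed.

Lemma hecke_act g (f : V0) : T (cind_act g f) = cind_act g (T f).
Proof.
apply/val_inj/funext => h; rewrite -[LHS]/(T (cind_act g f) h) hecke_eval.
rewrite -[RHS]/(T f (g^-1 * h)%g) hecke_eval.
by apply: eq_bigr => i _; rewrite -[LHS]/(f _) mulgA.
Qed.

(** * Invariants of the cokernel *)

Definition coker_fixed (f : V0) :=
  forall x, x \in KZ -> exists w, T w = cind_act x f - f.

Lemma coker_fixed_subT f w : coker_fixed f -> coker_fixed (f - T w).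
Proof.
move=> fK x /fK[u Tu]; exists (u - (cind_act x w - w)).
rewrite !linearB /= Tu hecke_act; apply/val_inj/funext => g.
by rewrite /= !fctE; ring.
Qed.

(** The element [y] of [KZ] fixes the vertex of [x * diag n] and sends its child
    [c] to its child [a c + b]. The change of [f] under this map does not depend
    on [c], and it is 0 because the map has a fixed point. *)
Lemma fixed_children f n x b : coker_fixed f -> vanish f n.+2 -> x \in KZ ->
  f (x * diag n * child b)%g = f (x * diag n * child 0)%g.
Proof.
move=> fK f0 xK; have [a aU a1U] := unit_sub1.
pose y := (x * upper (v a) (v (varpi ^+ n * b)%R) * x^-1)%g.
have yK : y \in KZ by rewrite !gpredM ?gpredV ?KZ_upper.
have [w Tw] := fK _ (etrans (gpredV KZ y) yK).
have w0n : vanish w n.+1.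
  apply: vanish_of_hecke => g gn; rewrite Tw cindB (f0 g) // subr0.
  by rewrite -[LHS]/(f _) f0 // invgK level_KZl.
have step c : f (x * diag n * child (a * c + b)%R)%g - f (x * diag n * child c)%g
    = w (x * diag n)%g.
  have := congr1 (fun h : V0 => h (x * diag n * child c)%g) Tw.
  have -> : T w (x * diag n * child c)%g = w (x * diag n)%g.
    rewrite -mulgA diag_child mulgA hecke_top ?gpredM ?KZ_upper1 //; last exact: vanishW w0n.
    have := diag_upper n (v c) (oner_neq0 K).
    rewrite -(rmorphXn v) -rmorphM => E.
    by rewrite -mulgA -E mulgA (cind_right _ _ (KZ_upper1 c)).
  move=> ->; rewrite cindB; congr (_ - _).
  rewrite -[RHS]/(f (y^-1^-1 * _)%g) invgK /y !mulgA mulgVK.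
  have := diag_upper n (v b) (v_unit aU).
  rewrite -(rmorphXn v) -rmorphM => E.
  have -> : (x * upper (v a) (v (varpi ^+ n * b)%R) * diag n * child c)%g
      = (x * diag n * child (a * c + b)%R * upper (v a) (v 0))%g.
    rewrite -[(x * upper _ _ * _)%g]mulgA -E -!mulgA; congr (x * (diag n * _))%g.
    rewrite /child !mul_upper ?(v_unit aU) // (rmorphD v) (rmorphM v) rmorph0 mulr0 add0r.
    by rewrite mulrC.
  by rewrite (cind_right _ _ (KZ_upper 0 aU)).
(* The fixed point of [c -> a c + b]. *)
pose c0 := - (b / (a - 1)).
have c0E : a * c0 + b = c0.
  apply/eqP; rewrite -subr_eq0 addrAC -{2}[c0]mul1r -mulrBl /c0 mulrN mulrC divrK //.
  by rewrite addNr.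
have w00 : w (x * diag n)%g = 0 by rewrite -(step c0) c0E subrr.
by have /eqP := step 0; rewrite w00 mulr0 add0r subr_eq0 => /eqP.
Qed.

Lemma childE0 : child 0 = diag 1.
Proof. by rewrite /child rmorph0 /diag expr1. Qed.

(** The first child of a vertex depends on how the vertex is represented, but the
    value of [f] there does not. Above the base vertex this is [fixed_children].
    The neighbours of the base vertex are all children: the remaining one, [None],
    is reached through the Weyl element, which moves [child 0] to it and fixes
    [child 1]. *)
Lemma fixed_top_well_defined f n x x' y y' :
  coker_fixed f -> vanish f n.+2 -> x \in KZ -> y \in KZ -> x' \in KZ -> y' \in KZ ->
  (x * diag n * y = x' * diag n * y')%g -> f (x * diag n.+1)%g = f (x' * diag n.+1)%g.
Proof.
move=> fK f0 xK yK x'K y'K E.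
have {}E : (x * diag n = x' * diag n * (y' * y^-1))%g by rewrite mulgA -E mulgK.
have [i [z [zK zE]]] := nbr_cover (gpredM _ _ y'K (etrans (gpredV KZ y) yK)).
have {}E : (x * diag n.+1 = x' * diag n * nbr i * z)%g.
  by rewrite -addn1 -diagD mulgA E -mulgA zE !mulgA.
rewrite E cind_right //; case: i E {zE} => [t|] E.
  by rewrite [nbr _]/(child _) fixed_children // childE0 -mulgA diagD addn1.
case: n f0 E => [|n] f0 E; last first.
  move/(congr1 level): E; rewrite level_KZdiag // level_KZr // -mulgA diag_nbrN mulgA.
  rewrite level_KZr ?KZ_scal // level_KZdiag // => /eqP.
  by rewrite -addn2 eqn_leq addn2 ltnNge leqnSn.
have c1 b u : u \in KZ -> f (u * child b)%g = f (u * diag 1)%g.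
  by move=> uK; have := fixed_children b fK f0 uK; rewrite diag0 mulg1 childE0.
rewrite diag0 mulg1 nbrNE !mulgA (cind_right _ _ KZ_weyl).
rewrite -(c1 1 (x' * weyl K)%g) ?gpredM ?KZ_weyl // -(c1 1 x') //.
rewrite /child rmorph1 -mulgA weyl_upper1 //.
have L : gl (-1) 0 (v varpi) 1 \in KZ.
  have := @KZ_gl (-1) 0 varpi 1; rewrite rmorphN rmorph1 rmorph0; apply.
  by rewrite mulr1 mul0r subr0 unitrN unitr1.
by rewrite mulgA (cind_right _ _ L).
Qed.

(** Here [w] is supported in level [n], and its value at a vertex is the common
    value of [f] at the children. *)
Lemma subtract_top f n : coker_fixed f -> vanish f n.+2 ->
  exists w, vanish (f - T w) n.+1.
Proof.
move=> fK f0; pose xof g := sval (cid (level_at g)).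
have xofP g : xof g \in KZ /\
    exists2 y, y \in KZ & g = (xof g * diag (level g) * y)%g.
  by rewrite /xof; case: cid => x [y [xK yK gE]] /=; split=> //; exists y.
pose w g : C^o := if level g == n then f (xof g * diag n.+1)%g else 0.
have wE x : x \in KZ -> w (x * diag n)%g = f (x * diag n.+1)%g.
  move=> xK; have [x'K [y yK E]] := xofP (x * diag n)%g.
  rewrite /w level_KZdiag // eqxx; rewrite level_KZdiag // in E.
  apply: (@fixed_top_well_defined f n _ _ y 1%g) => //; first exact: gpred1.
  by rewrite mulg1 -E.
have wP : w \in @cind_pred C _ KZ.
  apply/asboolP; split=> [g y yK|].
    rewrite /w level_KZr //; case: eqP => // gn.
    have [xK [z zK gE]] := xofP g; have [x'K [z' z'K g'E]] := xofP (g * y)%g.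
    rewrite level_KZr // gn in g'E; rewrite gn in gE.
    apply: (@fixed_top_well_defined f n _ _ z' (z * y)%g) => //.
      by rewrite gpredM.
    by rewrite -g'E mulgA -gE.
  have /asboolP[_ [s fs]] := cind_funP f.
  (* Every vertex in the support of [w] has a neighbour in that of [f]. *)
  exists [seq (h * nbr i)%g | h <- s, i <- enum {: option k}] => g.
  rewrite /w; case: (level g =P n) => [gn|_]; last by rewrite eqxx.
  have [xK [z zK gE]] := xofP g; move/fs => /hasP[h hs /= hK]; rewrite gn in gE.
  have [i [y [yK E]]] := nbr_cover (gpredM _ _ hK KZ_weyl).
  apply/hasP; exists (h * nbr i)%g.
    by apply/allpairsP; exists (h, i); rewrite mem_enum.
  have dV : (diag 1)^-1%g = (weyl K * diag 1 * (weyl K * scal (v varpi ^+ 1)^-1))%g.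
    exact: upperV_weyl.
  have -> : g = (h * nbr i * (y * (weyl K * scal (v varpi ^+ 1)^-1) * z))%g.
    rewrite [LHS]gE !mulgA -[(h * _ * y)%g]mulgA -E !mulgA mulgV mul1g.
    by rewrite -{1}[diag n](mulgK (diag 1)) diagD addn1 dV !mulgA.
  by rewrite mulKg !gpredM ?KZ_weyl ?KZ_scal ?invr_eq0.
exists (CInd wP) => g; rewrite leq_eqVlt => /orP[/eqP gn|gn]; rewrite cindB.
  have [x [y [xK yK ->]]] := level_at g; rewrite -gn !(cind_right _ _ yK).
  rewrite hecke_top //; first by rewrite -[X in _ - X]/(w _) wE // subrr.
  by move=> h hn; rewrite -[LHS]/(w h) /w gtn_eqF // ltnW.
rewrite f0 // (vanish_hecke (n := n.+1)) ?subrr // => h hn.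
by rewrite -[LHS]/(w h) /w gtn_eqF.
Qed.

(** The [KZ]-invariants of the cokernel of [T] are spanned by the class of the
    base vertex: push the support down one level at a time. *)
Lemma fixed_mod_hecke f : coker_fixed f ->
  exists c w, f = c *: cind_basis C KZ 1%g + T w.
Proof.
have [N] := vanish_ex f; move/(vanishW (leqnSn N)).
elim: N f => [|n IH] f f0 fK.
  exists (f 1%g), 0; rewrite linear0 addr0; apply/val_inj/funext => g.
  rewrite -[LHS]/(f g) -[RHS]/(f 1%g * (_ \in KZ)%:R) invg1 mul1g.
  case: (boolP (g \in KZ)) => gK; first by rewrite mulr1 -(cind_right f 1%g gK) mul1g.
  rewrite mulr0 f0 // lt0n; apply: contra gK => /eqP; exact: level0.
have [w w0n] := subtract_top fK f0.
have [c [u E]] := IH _ w0n (coker_fixed_subT w fK).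
by exists c, (u + w); rewrite linearD addrA -E subrK.
Qed.

Lemma basis1_notin_hecke w : T w = cind_basis C KZ 1%g -> False.
Proof.
move=> Tw; have w00 : w = 0.
  apply/val_inj/funext => g; rewrite -[LHS]/(w g); apply: (vanish_of_hecke (n := 0)) => // h h0.
  rewrite Tw /= invg1 mul1g; case: (boolP (h \in KZ)) => // hK.
  by move: h0; rewrite -[h]mul1g level_KZr // -[1%g]diag0 level_diag.
move/(congr1 (fun f : V0 => f 1%g)): Tw; rewrite w00 linear0 cind0 /= mulVg gpred1.
by move/eqP; rewrite eq_sym oner_eq0.
Qed.

End Tree.

(** * Endomorphisms of the universal supersingular representation *)

Lemma KZ_dvr_lattices (p : nat) (p_pr : prime p) (F : fieldExtType (Qp p_pr))
  (varpi : integers F) (e : nat) :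
  is_uniformizer varpi -> (0 < e)%N -> is_ramification_index varpi e ->
  dvr_lattices (val : integers F -> F) varpi (KZ F).
Proof.
move=> varpiP e_gt0 eP; split.
- exact: val_inj.
- by apply: contraNneq (varpi_neq0 e_gt0 eP) => ->; rewrite rmorph0.
- exact: varpiP.
- exact: (unit_varpi_factor varpiP e_gt0 eP).
- move=> x /(integer_or_inv varpiP e_gt0 eP)[H|H]; [left|right]; by exists (Integer H).
move=> g; split=> [/asboolP[h [z [[A Au hA] zZ ->]]]|[z [a [b [c [d [z0 D ->]]]]]]].
  have [t t0 ->] := center_scal zZ.
  exists t, (A 0 0), (A 0 1), (A 1 0), (A 1 1); split=> //.
    by rewrite -det_mx22 -mx22E -unitmxE.
  have -> : h = gl (val (A 0 0)) (val (A 0 1)) (val (A 1 0)) (val (A 1 1)).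
    have hE i j : val h i j = val (A i j) by rewrite [val h]hA mxE.
    by rewrite {1}[h]gl_eta !hE.
  exact/esym/scal_commute.
have Dv : val a * val d - val b * val c != 0 :> F.
  rewrite -!rmorphM -rmorphB /=; apply: contraTneq D => D0.
  have -> : a * d - b * c = 0 by apply: val_inj; rewrite /= D0.
  by rewrite unitr0.
apply/asboolP; exists (gl (val a) (val b) (val c) (val d)), (scal z); split.
- exists (mx22 a b c d); first by rewrite unitmxE det_mx22.
  by rewrite val_gl // [RHS]mx22E !mxE.
- by move=> y; apply: scal_commute.
- exact: scal_commute.
Qed.

Theorem theorem2p2
    (p : nat) (p_pr : prime p) (F : fieldExtType (Qp p_pr))
    (varpi : integers F) (e f : nat)
    (k : finFieldType) (red : {rmorphism integers F -> k})
    (teich : k -> integers F)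
    (C : closedFieldType) (iota : {rmorphism 'F_p -> C})
    (T : {linear ind0 F C -> ind0 F C})
    (varpiP : is_uniformizer varpi)
    (eP : is_ramification_index varpi e)
    (redP : is_residue_map varpi red)
    (fP : #|k| = (p ^ f)%N)
    (teichP : is_teichmuller red teich)
    (C_alg : forall x : C, algebraicOver iota x)
    (TP : is_hecke varpi teich T)
    (ef_gt1 : (1 < e * f)%N)
    (q_gt3 : (3 < p ^ f)%N)
    (phi : {linear pi0 T -> pi0 T})
    (phi_equiv : forall (g : GL2 F) (v : pi0 T),
       phi (pi0_act g v) = pi0_act g (phi v)) :
  exists! c : C, forall v : pi0 T, phi v = c *: v.
Proof.
have e_gt0 : (0 < e)%N by case: e ef_gt1 {eP}.
have V := KZ_dvr_lattices varpiP e_gt0 eP.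
have [[_ red0] [teichK _]] := (redP, teichP).
have k_gt2 : (2 < #|k|)%N by rewrite fP ltnW.
have Tact : forall (g : GL2 F) (v : ind0 F C), T (cind_act g v) = cind_act g (T v).
  exact: (hecke_act V red0 teichK TP).
have act_proj := pi0_act_proj Tact.
pose b1 : ind0 F C := bracket C 1%g.
have act_b1 (g : GL2 F) : cind_act g b1 = bracket C g by rewrite [LHS]cind_act_basis mulg1.
have bracketK (x : GL2 F) : x \in KZ F -> bracket C x = b1.
  move=> xK; apply/val_inj/funext => g /=.
  by rewrite invg1 mul1g gpredMl // gpredV.
have projP (u : ind0 F C) v : (exists w, T w = u - v) <-> pi0_proj T u = pi0_proj T v.
  by split=> [H|/eqP H]; [apply/eqP|]; apply/coker_eqP.
have projK (v : pi0 T) : pi0_proj T (repr (v : coker T)) = v := reprK _.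
have phi_b1_fixed : coker_fixed T (repr (phi (pi0_proj T b1) : coker T)).
  move=> x xK; apply/projP.
  by rewrite -act_proj projK -phi_equiv act_proj act_b1 bracketK.
have [c [w fE]] := fixed_mod_hecke V red0 teichK k_gt2 TP phi_b1_fixed.
have proj_T u : pi0_proj T (T u) = 0.
  transitivity (pi0_proj T 0); first by apply/projP; exists u; rewrite subr0.
  by have := pi0_proj_linear T (-1) 0 0; rewrite scaler0 addr0 scaleN1r addNr.
have phi_b1 : phi (pi0_proj T b1) = c *: pi0_proj T b1.
  by rewrite -[LHS]projK fE pi0_proj_linear proj_T addr0.
have b1_neq0 : pi0_proj T b1 != 0.
  apply/eqP => /esym; rewrite -(proj_T 0) linear0 => /esym/projP[u].
  rewrite subr0; exact: (basis1_notin_hecke V red0 teichK TP).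
exists c; split=> [v|c' /(_ (pi0_proj T b1))]; last first.
  rewrite phi_b1 => /eqP; rewrite -subr_eq0 -scalerBl scaler_eq0 (negPf b1_neq0) orbF.
  by rewrite subr_eq0 => /eqP.
rewrite -[v]projK; move: (repr _) => u; elim/cind_ind: u => [|a g u IH].
  by rewrite -(linear0 T) proj_T linear0 scaler0.
rewrite pi0_proj_linear linearP IH scalerDr scalerA [c * a]mulrC -scalerA.
congr (_ *: _ + _).
rewrite -[cind_basis _ _ g]/(bracket C g) -act_b1 -act_proj phi_equiv phi_b1.
have := pi0_proj_linear T c b1 0; have := pi0_proj_linear T c (cind_act g b1) 0.
rewrite -(linear0 T) proj_T !addr0 linear0 !addr0 => E1 E2.
by rewrite -E2 !act_proj -E1; congr (pi0_proj T _); apply/val_inj.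
Qed.
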